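(* Let $P$ be a polynomial with complex coefficients, $\deg(P)\geq 2$ and $P(0)\neq 0$, and let $f:\mathbb{C}\to\mathbb{C}$ be the entire function $f(z)=P(e^{z})/e^{z}$. Let $A(f)$ be the fast escaping set of $f$. Then for every horizontal strip $S\subset\mathbb{C}$ of width $2\pi$, the set $S\cap(\mathbb{C}\setminus A(f))$ has finite area.
   Context: Area means two-dimensional Lebesgue measure. A horizontal strip of width $2\pi$ is a set $\{z\in\mathbb{C}: a\leq \operatorname{Im} z\leq a+2\pi\}$ with $a\in\mathbb{R}$. $\mathbb{N}$ denotes the natural numbers, including $0$. For a transcendental entire function $f$, $f^{\circ n}$ denotes its $n$-th iterate. The maximal modulus function is $M(r)=M(r,f):=\max_{|z|=r}|f(z)|$ for $r>0$, and $M^{\circ n}$ denotes the $n$-th iterate of $r\mapsto M(r)$. The fast escaping set is $$A(f):=\{z\in\mathbb{C}: \text{ there is } \ell\in\mathbb{N} \text{ such that } |f^{\circ(n+\ell)}(z)|\geq M^{\circ n}(R) \text{ for all } n\in\mathbb{N}\},$$ where $R>0$ is a constant such that $M^{\circ n}(R)\to\infty$ as $n\to\infty$; it is known that $A(f)$ does not depend on the choice of such $R$. *)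

(* Defs.v *)
From HB Require Import structures.
From mathcomp Require Import all_boot all_order all_algebra.
From mathcomp Require Import all_classical all_reals all_analysis.
From mathcomp Require Import complex.
Import Order.TTheory GRing.Theory Num.Theory.
Import numFieldTopology.Exports.

Set Implicit Arguments.
Unset Strict Implicit.
Unset Printing Implicit Defensive.

Local Open Scope classical_set_scope.
Local Open Scope ring_scope.
Local Open Scope complex_scope.

Section ComplexPlane.
Context {R : realType}.

Definition cexp (z : R[i]) : R[i] :=
  (expR (complex.Re z) * cos (complex.Im z)) +i* (expR (complex.Re z) * sin (complex.Im z)).

(* [`|z|] lives in [R[i]]; [cmod] is the modulus as a real number. *)
Definition cmod (z : R[i]) : R := Normc.normc z.

Definition plane_set (A : set R[i]) : set (measurableTypeR R * measurableTypeR R) :=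
  [set p | A (p.1 +i* p.2)].

(* The product measure is only meaningful on (Borel) measurable sets, so
   having finite area includes measurability. *)
Definition finite_area (A : set R[i]) : Prop :=
  measurable (plane_set A) /\
  ((@lebesgue_measure R \x @lebesgue_measure R) (plane_set A) < +oo)%E.

Definition horizontal_strip (a : R) : set R[i] :=
  [set z | a <= complex.Im z <= a + 2 * pi].

End ComplexPlane.

Section FastEscaping.
Context {R : realType}.
Variable f : R[i] -> R[i].

(* For continuous [f] and [r >= 0] this supremum is a maximum. *)
Definition max_modulus (r : R) : R :=
  sup [set cmod (f z) | z in [set z | cmod z = r]].

Definition admissible_radius (r0 : R) : Prop :=
  0 < r0 /\ iter n max_modulus r0 @[n --> \oo] --> +oo.

(* For transcendental entire [f] this is the fast escaping set A(f), the same
   for every admissible radius [r0]. *)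
Definition fast_escaping (r0 : R) : set R[i] :=
  [set z | exists l : nat, forall n : nat,
     iter n max_modulus r0 <= cmod (iter (n + l) f z)].

End FastEscaping.

(* Main.v *)
Require Import Defs.
From HB Require Import structures.
From mathcomp Require Import all_boot all_order all_algebra.
From mathcomp Require Import all_classical all_reals all_analysis.
From mathcomp Require Import measurable_realfun.
From mathcomp Require Import complex.
From mathcomp Require Import ring lra.
Import Order.TTheory GRing.Theory Num.Theory.
Import numFieldTopology.Exports.

Local Open Scope classical_set_scope.
Local Open Scope ring_scope.
Local Open Scope complex_scope.

Set Implicit Arguments.
Unset Strict Implicit.
Unset Printing Implicit Defensive.

(* Far from the imaginary axis [f] behaves like a single exponential, so [z] escapes fast
   as soon as [|Re f^(k+1)(z)| >= exp (|Re f^k(z)| / 2)] for all [k].  This fails for the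
   step from [w] to [f w] only if [f w] lies in a thin double sector around the imaginary
   axis.  By Fubini it suffices to bound, on a vertical line at distance [X] from the
   imaginary axis, the length of the set of points that ever fail by [O(1 / X^2)].
   [f] maps only a small proportion of a short, nearly straight, not nearly horizontal arc
   into the bad sector, because [arg f] moves along the arc at a definite speed.  The image,
   cut into short pieces, consists again of such arcs, except for few pieces that are nearly
   horizontal: the tangent gets multiplied by [f'], and [arg f'] moves like [arg f].  The
   new arcs are at distance at least [exp (X / 2)] from the axis, so the proportions lost
   at the successive steps have a sum of the order of the first one. *)

(** * Modulus and exponential of complex numbers, with explicit remainders *)

Section Modulus.
Context {R : realType}.
Local Arguments cmod : simpl never.
Implicit Types (x y : R) (z w : R[i]).

Lemma cmodM z w : cmod (z * w) = cmod z * cmod w.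
Proof. exact: Normc.normcM. Qed.

Lemma cmodD_le z w : cmod (z + w) <= cmod z + cmod w.
Proof. exact: le_normcD. Qed.

Lemma cmod0 : cmod (0 : R[i]) = 0.
Proof. exact: Normc.normc0. Qed.

Lemma cmodN z : cmod (- z) = cmod z.
Proof. exact: normcN. Qed.

Lemma cmod_distC z w : cmod (z - w) = cmod (w - z).
Proof. by rewrite -cmodN opprB. Qed.

Lemma cmodB_le z w : cmod (z - w) <= cmod z + cmod w.
Proof. by rewrite -[cmod w]cmodN; exact: cmodD_le. Qed.

Lemma cmod_leD z w : cmod z <= cmod w + cmod (z - w).
Proof. by rewrite -{1}[z](subrK w) addrC; exact: cmodD_le. Qed.

Lemma cmod_ge0 z : 0 <= cmod z.
Proof. by case: z => x y; exact: sqrtr_ge0. Qed.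

Lemma cmod_sqr z : cmod z ^+ 2 = complex.Re z ^+ 2 + complex.Im z ^+ 2.
Proof. by case: z => x y /=; rewrite sqr_sqrtr// addr_ge0// sqr_ge0. Qed.

Lemma cmod_gt0 z : (0 < cmod z) = (z != 0).
Proof.
rewrite lt_def cmod_ge0 andbT; congr negb; apply/eqP/eqP => [/Normc.eq0_normc //|->].
exact: cmod0.
Qed.

Lemma cmod_real x : cmod x%:C = `|x|.
Proof. by rewrite /cmod /= expr0n/= addr0 sqrtr_sqr. Qed.

Lemma Re_le_cmod z : `|complex.Re z| <= cmod z.
Proof.
by rewrite -ler_sqr ?nnegrE ?cmod_ge0// cmod_sqr real_normK ?num_real// lerDl sqr_ge0.
Qed.

Lemma Im_le_cmod z : `|complex.Im z| <= cmod z.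
Proof.
by rewrite -ler_sqr ?nnegrE ?cmod_ge0// cmod_sqr real_normK ?num_real// lerDr sqr_ge0.
Qed.

Lemma cmod_le_ReIm z : cmod z <= `|complex.Re z| + `|complex.Im z|.
Proof.
rewrite -ler_sqr ?nnegrE ?cmod_ge0 ?addr_ge0// cmod_sqr sqrrD.
rewrite !real_normK ?num_real// [leRHS]addrAC lerDl.
by rewrite mulrn_wge0// mulr_ge0.
Qed.

Lemma ReD z w : complex.Re (z + w) = complex.Re z + complex.Re w.
Proof. by case: z w => ? ? [? ?]. Qed.

Lemma ImD z w : complex.Im (z + w) = complex.Im z + complex.Im w.
Proof. by case: z w => ? ? [? ?]. Qed.

Lemma ImN z : complex.Im (- z) = - complex.Im z.
Proof. by case: z. Qed.

Lemma ImM z w : complex.Im (z * w) =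
  complex.Re z * complex.Im w + complex.Im z * complex.Re w.
Proof. by case: z w => ? ? [? ?] /=; rewrite [X in _ + X]mulrC. Qed.

Lemma ReM z w : complex.Re (z * w) =
  complex.Re z * complex.Re w - complex.Im z * complex.Im w.
Proof. by case: z w => ? ? [? ?]. Qed.

Lemma cmod_cexp z : cmod (cexp z) = expR (complex.Re z).
Proof.
rewrite /cmod /Normc.normc /= !exprMn -mulrDr cos2Dsin2 mulr1 sqrtr_sqr ger0_norm// expR_ge0.
Qed.

Lemma cexpD z w : cexp (z + w) = cexp z * cexp w.
Proof.
case: z w => x y [x' y']; rewrite /cexp/= cosD sinD expRD.
by apply/eqP; rewrite eq_complex /=; apply/andP; split; apply/eqP; ring.
Qed.

Lemma cexp0 : cexp (0 : R[i]) = 1.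
Proof. by rewrite /cexp/= expR0 cos0 sin0 mulr1 mulr0. Qed.

Lemma cexp_neq0 z : cexp z != 0.
Proof. by rewrite -cmod_gt0 cmod_cexp expR_gt0. Qed.

Lemma cexpN z : cexp (- z) = (cexp z)^-1.
Proof.
apply: (mulfI (cexp_neq0 z)); rewrite -cexpD subrr cexp0 divff//.
exact: cexp_neq0.
Qed.

Lemma cexpMn z n : cexp (n%:R * z) = cexp z ^+ n.
Proof.
elim: n => [|n IH]; first by rewrite mul0r cexp0 expr0.
by rewrite -natr1 mulrDl mul1r cexpD IH exprSr.
Qed.

Lemma sin_le_norm y : `|sin y| <= `|y|.
Proof.
wlog y0 : y / 0 < y => [hw|].
  have [y0|y0|->] := ltgtP y 0; last by rewrite sin0.
  - by rewrite -[leRHS]normrN -[leLHS]normrN -sinN hw// oppr_gt0.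
  - exact: hw.
have [|c _] := @MVT R sin cos 0 y y0.
- by apply: derivable_within_continuous => x _; exact: ex_derive.
rewrite sin0 !subr0 => ->; rewrite normrM ler_piMl// ler_norml.
by rewrite cos_geN1 cos_le1.
Qed.

Lemma cos_sub1_norm y : `|cos y - 1| <= y ^+ 2 / 2.
Proof.
have -> : cos y - 1 = - (2 * sin (y / 2) ^+ 2).
  have {1}-> : y = y / 2 + y / 2 by lra.
  by rewrite cosD; have := cos2Dsin2 (y / 2); nra.
rewrite normrN normrM ger0_norm// normrX.
have := sin_le_norm (y / 2); rewrite -ler_sqr ?nnegrE//.
rewrite [`|y / 2| ^+ 2]real_normK ?num_real//; lra.
Qed.

Lemma sin_sub_norm y : `|y| <= 1 -> `|sin y - y| <= y ^+ 2.
Proof.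
wlog y0 : y / 0 < y => [hw|].
  have [y0|y0|->] := ltgtP y 0; last by rewrite sin0 subrr normr0 sqr_ge0.
  - rewrite -normrN => /hw; rewrite oppr_gt0 sinN -opprD normrN sqrrN; exact.
  - exact: hw.
move=> y1.
have [|c] /=:= @MVT R (fun x => sin x - x) (fun x => cos x - 1) 0 y y0.
- by apply: derivable_within_continuous => x _; exact: ex_derive.
rewrite in_itv/= sin0 !subr0 => /andP[c0 cy] ->; rewrite normrM expr2 (gtr0_norm y0).
rewrite ler_wpM2r ?(ltW y0)//; apply: le_trans (cos_sub1_norm _) _.
move: y1; rewrite gtr0_norm// => y1; nra.
Qed.

(** The single inequality [1 + y <= expR y], taken at [y = x] and at [y = - x], gives
    [1 + x <= expR x <= 1 / (1 - x)]. *)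
Lemma expR_sub1_norm x : `|x| <= 2^-1 ->
  `|expR x - 1 - x| <= 2 * x ^+ 2 /\ `|expR x - 1| <= 2 * `|x|.
Proof.
rewrite ler_norml => /andP[x1 x2].
have lb := expR_ge1Dx x; have := expR_ge1Dx (- x); rewrite expRN => ub.
have ub' : expR x * (1 - x) <= 1.
  by rewrite -ler_pdivlMl ?expR_gt0// mulr1.
have ub2 : expR x <= 1 + x + 2 * x ^+ 2.
  rewrite -(@ler_pM2r _ (1 - x)); last lra.
  apply: le_trans ub' _; nra.
split; first by rewrite ger0_norm; lra.
rewrite ler_norml; apply/andP; split; have [] := ler0P x; nra.
Qed.

(** For [z = x + i y] the remainder has real part [(e^x - 1 - x) + e^x (cos y - 1)] and imaginary
    part [e^x (sin y - y) + (e^x - 1) y]; all four terms are quadratically small. *)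
Lemma cexp_taylor z : cmod z <= 2^-1 ->
  cmod (cexp z - 1 - z) <= 10 * cmod z ^+ 2.
Proof.
move=> z1; have := Re_le_cmod z; have := Im_le_cmod z.
case: z z1 => x y z1 /= yz xz.
have [e1 e2] := expR_sub1_norm (le_trans xz z1).
have half1 : 2^-1 <= 1 :> R by lra.
have s1 := sin_sub_norm (le_trans yz (le_trans z1 half1)).
have c1 := cos_sub1_norm y.
set m := cmod _ in z1 yz xz *.
have m0 : 0 <= m by exact: cmod_ge0.
have x2 : x ^+ 2 <= m ^+ 2 by rewrite -real_normK ?num_real// ler_sqr ?nnegrE.
have y2 : y ^+ 2 <= m ^+ 2 by rewrite -real_normK ?num_real// ler_sqr ?nnegrE.
have xy : `|x| * `|y| <= m ^+ 2 by rewrite expr2 ler_pM.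
have e3 : expR x <= 2.
  by move: e2; rewrite ler_norml => /andP[_]; move: (le_trans xz z1); lra.
have e0 : 0 < expR x by exact: expR_gt0.
apply: le_trans (cmod_le_ReIm _) _ => /=; rewrite oppr0 addr0.
have -> : expR x * cos y - 1 - x = (expR x - 1 - x) + expR x * (cos y - 1) by ring.
have -> : expR x * sin y - y = expR x * (sin y - y) + (expR x - 1) * y by ring.
have h1 : `|expR x * (cos y - 1)| <= 2 * (m ^+ 2 / 2).
  rewrite normrM (gtr0_norm e0); apply: ler_pM => //.
  by apply: le_trans c1 _; rewrite ler_wpM2r.
have h2 : `|expR x * (sin y - y)| <= 2 * m ^+ 2.
  rewrite normrM (gtr0_norm e0); apply: ler_pM => //.
  exact: le_trans s1 _.
have h3 : `|(expR x - 1) * y| <= 2 * m ^+ 2.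
  rewrite normrM; apply: le_trans (ler_wpM2r _ e2) _ => //.
  by rewrite -mulrA; lra.
have t1 := ler_normD (expR x - 1 - x) (expR x * (cos y - 1)).
have t2 := ler_normD (expR x * (sin y - y)) ((expR x - 1) * y).
apply: le_trans (lerD t1 t2) _.
apply: le_trans (lerD (lerD e1 h1) (lerD h2 h3)) _; have := sqr_ge0 m; lra.
Qed.

End Modulus.

(** * Exponential polynomials far from the imaginary axis *)

Section ExponentialPolynomials.
Context {R : realType}.
Local Arguments cmod : simpl never.
Implicit Types (a : nat -> R[i]) (n k : nat) (x : R) (z w u : R[i]).

(* The exponents run over [-1, 0, ..., n - 2]. *)
Definition exp_poly a n z : R[i] :=
  \sum_(k < n) a k * cexp ((k%:R - 1 : R)%:C * z).

(** The coefficients of the derivative of [exp_poly a n]; differentiation is expressed by the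
    estimate [exp_poly_taylor]. *)
Definition exp_poly_deriv a k : R[i] := a k * (k%:R - 1 : R)%:C.

Definition coef_norm a n : R := \sum_(k < n) cmod (a k).

Lemma coef_norm_ge0 a n : 0 <= coef_norm a n.
Proof. by apply: sumr_ge0 => k _; exact: cmod_ge0. Qed.

Lemma cmod_le_coef_norm a n k : (k < n)%N -> cmod (a k) <= coef_norm a n.
Proof.
move=> kn; rewrite /coef_norm (bigD1 (Ordinal kn))//= lerDl.
by apply: sumr_ge0 => *; exact: cmod_ge0.
Qed.

Lemma cmod_sum n (F : 'I_n -> R[i]) : cmod (\sum_(k < n) F k) <= \sum_(k < n) cmod (F k).
Proof.
apply: (big_ind2 (fun z (y : R) => cmod z <= y)) => //; first by rewrite cmod0.
by move=> z y w v zy wv; apply: le_trans (cmodD_le _ _) _; exact: lerD.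
Qed.

Lemma cmod_sum_weighted a n (F : 'I_n -> R[i]) (B : R) :
  (forall k : 'I_n, cmod (F k) <= cmod (a k) * B) ->
  cmod (\sum_(k < n) F k) <= coef_norm a n * B.
Proof.
move=> FB; apply: le_trans (cmod_sum _) _; rewrite mulr_suml.
by apply: ler_sum => k _.
Qed.

Lemma cmod_exp_term k z :
  cmod (cexp ((k%:R - 1 : R)%:C * z)) = expR ((k%:R - 1) * complex.Re z).
Proof. by rewrite cmod_cexp ReM /= mul0r subr0. Qed.

Lemma exponent_norm n k : (k < n)%N -> `|k%:R - 1 : R| <= n%:R.
Proof.
move=> kn; have : (k%:R + 1 <= n%:R :> R) by rewrite natr1 ler_nat.
by have := ler0n R k; rewrite ler_norml => ? ?; apply/andP; split; lra.
Qed.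

(** Term by term from [cexp_taylor] at [c * u], where [c] is the exponent: as [|c| <= n], the
    smallness of [u] puts [c * u] in the disc of radius [1 / 2]. *)
Lemma exp_poly_taylor a n w u (W : R) :
  (forall k, (k < n)%N -> expR ((k%:R - 1) * complex.Re w) <= W) ->
  2 * n%:R * cmod u <= 1 ->
  cmod (exp_poly a n (w + u) - exp_poly a n w - exp_poly (exp_poly_deriv a) n w * u)
    <= coef_norm a n * (10 * n%:R ^+ 2 * W * cmod u ^+ 2).
Proof.
move=> hW hu; rewrite /exp_poly mulr_suml -!sumrB; apply: cmod_sum_weighted => k.
set c : R := k%:R - 1; rewrite /exp_poly_deriv -/c mulrDr cexpD.
set E := cexp (c%:C * w).
have -> : a k * (E * cexp (c%:C * u)) - a k * E - a k * c%:C * E * u =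
          a k * (E * (cexp (c%:C * u) - 1 - c%:C * u)) by ring.
rewrite !cmodM ler_wpM2l ?cmod_ge0//.
have EW : cmod E <= W by rewrite cmod_exp_term hW.
have cn : `|c| <= n%:R by exact: exponent_norm.
have cu : cmod (c%:C * u) <= n%:R * cmod u.
  by rewrite cmodM cmod_real ler_wpM2r ?cmod_ge0.
have h : cmod (cexp (c%:C * u) - 1 - c%:C * u) <= 10 * cmod (c%:C * u) ^+ 2.
  by apply: cexp_taylor; lra.
have -> : 10 * n%:R ^+ 2 * W * cmod u ^+ 2 =
  W * (10 * (n%:R * cmod u) ^+ 2) by ring.
apply: ler_pM; rewrite ?cmod_ge0//; apply: le_trans h _.
by rewrite ler_pM2l// ler_sqr ?nnegrE ?cmod_ge0// mulr_ge0 ?cmod_ge0.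
Qed.

(** The gap [|Re w|] in the exponents makes every term other than the [K]-th smaller by the factor
    [expR (- |Re w|)]. *)
Lemma exp_poly_dominant a n K w :
  (K < n)%N ->
  (forall k, (k < n)%N -> k != K ->
     (k%:R - 1) * complex.Re w <= (K%:R - 1) * complex.Re w - `|complex.Re w|) ->
  cmod (exp_poly a n w - a K * cexp ((K%:R - 1 : R)%:C * w)) <=
  coef_norm a n * (expR ((K%:R - 1) * complex.Re w) * expR (- `|complex.Re w|)).
Proof.
move=> Kn hK; rewrite /exp_poly (bigD1 (Ordinal Kn))//= addrAC subrr add0r.
apply: le_trans (_ : \sum_(k < n | k != Ordinal Kn) cmod (a k) *
  (expR ((K%:R - 1) * complex.Re w) * expR (- `|complex.Re w|)) <= _).
  apply: (big_ind2 (fun z (y : R) => cmod z <= y)) => //.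
  - by rewrite cmod0.
  - by move=> z y v y' zy wv; apply: le_trans (cmodD_le _ _) _; exact: lerD.
  - move=> k kK; rewrite cmodM ler_wpM2l ?cmod_ge0// cmod_exp_term -expRD.
    by rewrite ler_expR hK.
rewrite -mulr_suml ler_wpM2r ?mulr_ge0 ?expR_ge0//.
by rewrite /coef_norm [leRHS](bigD1 (Ordinal Kn))//= lerDr cmod_ge0.
Qed.

(** To the right of the imaginary axis the last exponent [n - 2] wins, which is at least [1] by
    [3 <= n]; to the left the exponent [-1] wins. Exponents differ by at least [1], whence the gap
    [|x|]. *)
Lemma dominant_exponent n x : (3 <= n)%N ->
  exists K, [/\ (K < n)%N, K = 0%N \/ K = n.-1, `|x| <= (K%:R - 1) * x,
    1 <= `|K%:R - 1 : R| &
    forall k, (k < n)%N -> k != K -> (k%:R - 1) * x <= (K%:R - 1) * x - `|x|].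
Proof.
case: n => [//|[//|[//|n _]]]; have [x0|x0] := lerP 0 x.
- have n0 := ler0n R n.
  have e : n.+2%:R = n%:R + 2 :> R by rewrite -addn2 natrD.
  exists n.+2; split => //; [by right|by rewrite e ger0_norm//; nra| |].
    by rewrite e ger0_norm; lra.
  move=> k kn kK; have : (k%:R <= n.+1%:R :> R) by rewrite ler_nat -ltnS ltn_neqAle kK -ltnS.
  by rewrite e -natr1 ger0_norm// => h; nra.
- exists 0%N; split => //; [by left|rewrite ltr0_norm//; lra|by rewrite sub0r normrN normr1|].
  move=> k _; rewrite -lt0n => k0; have : (1 <= k%:R :> R) by rewrite ler1n.
  by rewrite ltr0_norm// => h; nra.
Qed.

Lemma exp_poly_growth a n z :
  cmod (exp_poly a n z) <= coef_norm a n * expR (n%:R * cmod z).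
Proof.
apply: cmod_sum_weighted => k; rewrite cmodM ler_wpM2l ?cmod_ge0// cmod_exp_term.
rewrite ler_expR; apply: le_trans (ler_norm _) _; rewrite normrM.
by apply: ler_pM => //; [exact: exponent_norm|exact: Re_le_cmod].
Qed.

Lemma poly_cexp_div (P : {poly R[i]}) z :
  P.[cexp z] / cexp z = exp_poly (fun k => P`_k) (size P) z.
Proof.
rewrite horner_coef mulr_suml; apply: eq_bigr => k _.
rewrite -mulrA; congr (_ * _).
rewrite rmorphB rmorph1 rmorph_nat mulrBl mul1r.
by rewrite cexpD cexpN cexpMn.
Qed.

(* The analytic input on [f]: far from the imaginary axis, [f] and its derivative [f']
   are comparable, large, and both behave like an exponential with real exponent [m]. *)
Record exp_like (f f' : R[i] -> R[i]) (C X0 : R) : Prop := ExpLike {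
  exp_like_large w : X0 <= `|complex.Re w| -> expR `|complex.Re w| <= C * cmod (f w) ;
  exp_like_le_deriv w : X0 <= `|complex.Re w| -> cmod (f w) <= 2 * cmod (f' w) ;
  exp_like_deriv_le w : X0 <= `|complex.Re w| -> cmod (f' w) <= C * cmod (f w) ;
  exp_like_taylor w u : X0 <= `|complex.Re w| -> C * cmod u <= 1 ->
    cmod (f (w + u) - f w - f' w * u) <= C * cmod (f w) * cmod u ^+ 2 ;
  exp_like_exponent w : X0 <= `|complex.Re w| -> exists m : R,
    1 <= `|m| <= C /\ forall u, C * cmod u <= 1 -> forall g, g = f \/ g = f' ->
      cmod (g (w + u) - g w - m%:C * g w * u) <=
        C * cmod (g w) * (cmod u ^+ 2 + expR (- `|complex.Re w|) * cmod u) }.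

(** Far from the axis [f], [f'] and [f''] are close to [a K * E], [a K * m * E] and [a K * m^2 * E]
    with [E = cexp (m * w)], up to a relative error of order [expR (- |Re w|)]. Hence [m] serves as
    logarithmic derivative of both [f] and [f']. *)
Lemma exp_poly_exp_like a n : (3 <= n)%N -> a 0%N != 0 -> a n.-1 != 0 ->
  exists C X0, 200 <= C /\ exp_like (exp_poly a n) (exp_poly (exp_poly_deriv a) n) C X0.
Proof.
move=> n3 a0 an.
pose a' := exp_poly_deriv a; pose a'' := exp_poly_deriv a'.
pose S := coef_norm a n + coef_norm a' n + coef_norm a'' n.
have aS : coef_norm a n <= S.
  by rewrite /S; have := coef_norm_ge0 a' n; have := coef_norm_ge0 a'' n; lra.
have a'S : coef_norm a' n <= S.
  by rewrite /S; have := coef_norm_ge0 a n; have := coef_norm_ge0 a'' n; lra.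
have a''S : coef_norm a'' n <= S.
  by rewrite /S; have := coef_norm_ge0 a n; have := coef_norm_ge0 a' n; lra.
(* Which outer coefficient dominates depends on the sign of [Re w]; [c] bounds both from below. *)
pose c := Num.min (cmod (a 0%N)) (cmod (a n.-1)).
have c0 : 0 < c by rewrite lt_min !cmod_gt0 a0 an.
pose Q : R := n%:R; have Q3 : 3 <= Q by rewrite ler_nat.
pose T := S / c.
have T1 : 1 <= T.
  rewrite ler_pdivlMr// mul1r; apply: le_trans aS; apply: (@le_trans _ _ (cmod (a 0%N))); first by rewrite ge_min lexx.
  by apply: cmod_le_coef_norm; case: (n) n3.
have ST : S = T * c by rewrite /T divfK// gt_eqF.
(* [C] sums one term for each inequality it has to satisfy; the choice of [X0] below makes the
   relative error [(1 + Q) * T * e] at most [1 / 4]. *)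
pose C := 200 + 2 * Q + 2 / c + 40 * (1 + Q) ^+ 2 * T.
have ic0 : 0 < c^-1 by rewrite invr_gt0.
exists C, (4 * (1 + Q) * T).
have QT0 : 0 <= (1 + Q) * T by nra.
have QT1 : (1 + Q) * T <= (1 + Q) ^+ 2 * T by nra.
have QT2 : Q ^+ 2 * T <= (1 + Q) ^+ 2 * T by nra.
have C1 : 1 <= C by rewrite /C; lra.
have CQ : 2 * Q <= C by rewrite /C; lra.
have Cc : 2 / c <= C by rewrite /C; lra.
have CT : 4 * ((1 + Q) * T) <= C by rewrite /C; lra.
have CT2 : 40 * (Q ^+ 2 * T) <= C by rewrite /C; lra.
have C200 : 200 <= C by rewrite /C; lra.
clearbody C; clearbody T.
split => //; suff H w : 4 * (1 + Q) * T <= `|complex.Re w| ->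
   [/\ expR `|complex.Re w| <= C * cmod (exp_poly a n w),
       cmod (exp_poly a n w) <= 2 * cmod (exp_poly a' n w),
       cmod (exp_poly a' n w) <= C * cmod (exp_poly a n w),
       forall u, C * cmod u <= 1 ->
         cmod (exp_poly a n (w + u) - exp_poly a n w - exp_poly a' n w * u) <=
           C * cmod (exp_poly a n w) * cmod u ^+ 2 &
       exists m : R, 1 <= `|m| <= C /\ forall u, C * cmod u <= 1 ->
        forall g, g = exp_poly a n \/ g = exp_poly a' n ->
      cmod (g (w + u) - g w - m%:C * g w * u) <=
        C * cmod (g w) * (cmod u ^+ 2 + expR (- `|complex.Re w|) * cmod u)].
  by split => [w /H[]|w /H[]|w /H[]|w u /H[]|w /H[]] // *; auto.
set x := complex.Re w => hx.
have [K [Kn K0 Kx m1 Kk]] := dominant_exponent x n3.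
pose m : R := K%:R - 1; pose W := expR (m * x); pose e := expR (- `|x|).
have W0 : 0 < W by exact: expR_gt0.
have e0 : 0 < e by exact: expR_gt0.
have eT : 4 * ((1 + Q) * T) * e <= 1.
  rewrite /e expRN ler_pdivrMr ?expR_gt0// mul1r.
  by have := expR_ge1Dx `|x|; lra.
have eW : expR `|x| <= W by rewrite ler_expR.
have hW k : (k < n)%N -> expR ((k%:R - 1) * x) <= W.
  move=> kn; have [->//|kK] := eqVneq k K; rewrite ler_expR.
  by apply: le_trans (Kk _ kn kK) _; rewrite gerBl.
pose E := cexp (m%:C * w); have EW : cmod E = W by rewrite cmod_exp_term.
have mQ : `|m| <= Q by exact: exponent_norm.
have aK : c <= cmod (a K) by rewrite /c; case: K0 => ->; rewrite ge_min lexx ?orbT.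
have d0 : cmod (exp_poly a n w - a K * E) <= S * (W * e).
  apply: le_trans (exp_poly_dominant a Kn Kk) _.
  by rewrite ler_wpM2r// mulr_ge0// ltW.
have d1 : cmod (exp_poly a' n w - a K * m%:C * E) <= S * (W * e).
  apply: le_trans (exp_poly_dominant a' Kn Kk) _.
  by rewrite ler_wpM2r// mulr_ge0// ltW.
have d2 : cmod (exp_poly a'' n w - a K * m%:C * m%:C * E) <= S * (W * e).
  apply: le_trans (exp_poly_dominant a'' Kn Kk) _.
  by rewrite ler_wpM2r// mulr_ge0// ltW.
have Wc0 : 0 < W * c by rewrite mulr_gt0.
have QTe : (1 + Q) * T * e * (W * c) <= W * c / 4 by rewrite mulrC ler_wpM2l ?(ltW Wc0)//; lra.
have TQT : T * e * (W * c) <= (1 + Q) * T * e * (W * c).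
  by rewrite ler_wpM2r ?(ltW Wc0)// ler_wpM2r ?(ltW e0)//; nra.
have f_lb : W * c <= 2 * cmod (exp_poly a n w).
  have := cmod_leD (a K * E) (exp_poly a n w); rewrite cmod_distC cmodM EW.
  have := ler_wpM2l (ltW W0) aK; move: d0; rewrite ST; lra.
(* The main terms cancel in [g' - m * g]. This is used for the pairs [f, f'] and [f', f'']. *)
have near g g' (b : R[i]) : cmod (g - b * E) <= S * (W * e) ->
    cmod (g' - b * m%:C * E) <= S * (W * e) ->
    cmod (g' - m%:C * g) <= (1 + Q) * T * e * (W * c).
  move=> h h'; have -> : g' - m%:C * g = (g' - b * m%:C * E) - m%:C * (g - b * E) by ring.
  apply: le_trans (cmodB_le _ _) _; rewrite cmodM cmod_real.
  have h2 := ler_pM (normr_ge0 m) (cmod_ge0 _) mQ h.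
  have := lerD h' h2; rewrite ST; lra.
have n1 := near _ _ _ d0 d1.
have n2 := near _ _ _ d1 d2.
set f0 := cmod (exp_poly a n w) in f_lb *; set f1 := cmod (exp_poly a' n w).
have f00 : 0 <= f0 by exact: cmod_ge0.
have f'_lb : f0 <= 2 * f1.
  have := cmod_leD (m%:C * exp_poly a n w) (exp_poly a' n w).
  rewrite cmod_distC cmodM cmod_real -/f0 -/f1.
  have := ler_wpM2r f00 m1; move: f_lb QTe n1; clear; lra.
have f'_ub : f1 <= C * f0.
  have := cmod_leD (exp_poly a' n w) (m%:C * exp_poly a n w).
  rewrite cmodM cmod_real -/f0 -/f1.
  have := ler_wpM2r f00 mQ; have : (Q + 1) * f0 <= C * f0 by rewrite ler_wpM2r//; lra.
  lra.
have taylor b u : coef_norm b n <= S -> C * cmod u <= 1 ->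
    cmod (exp_poly b n (w + u) - exp_poly b n w - exp_poly (exp_poly_deriv b) n w * u)
      <= 10 * (Q ^+ 2 * T) * (W * c) * cmod u ^+ 2.
  move=> bS Cu; have u0 := cmod_ge0 u.
  apply: le_trans (exp_poly_taylor b hW _) _.
    by apply: le_trans Cu; rewrite ler_wpM2r.
  have -> : 10 * (Q ^+ 2 * T) * (W * c) * cmod u ^+ 2 =
    S * (10 * n%:R ^+ 2 * W * cmod u ^+ 2) by rewrite ST /Q; ring.
  rewrite ler_wpM2r// !mulr_ge0 ?sqr_ge0 ?(ltW W0)//.
have Q2T : 0 <= Q ^+ 2 * T by rewrite mulr_ge0 ?sqr_ge0//; lra.
split=> //.
- apply: (@le_trans _ _ (2 / c * f0)); last by rewrite ler_wpM2r.
  by rewrite mulrAC ler_pdivlMr// (le_trans _ f_lb)// ler_wpM2r// ltW.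
- move=> u Cu; apply: le_trans (taylor a u aS Cu) _.
  rewrite ler_wpM2r ?sqr_ge0//.
  apply: (@le_trans _ _ (10 * (Q ^+ 2 * T) * (2 * f0))).
    by rewrite ler_wpM2l// mulr_ge0.
  have := ler_wpM2r f00 CT2; have := mulr_ge0 Q2T f00; clear; lra.
- exists m; split; first by rewrite m1; lra.
  move=> u Cu; have u0 := cmod_ge0 u.
  (* In Taylor's formula the derivative is replaced by [m] times the function: the remainder gives
     the term [cmod u ^+ 2], the replacement the term with [e]. *)
  have key b : coef_norm b n <= S -> W * c <= 4 * cmod (exp_poly b n w) ->
      cmod (exp_poly (exp_poly_deriv b) n w - m%:C * exp_poly b n w)
        <= (1 + Q) * T * e * (W * c) ->
      cmod (exp_poly b n (w + u) - exp_poly b n w - m%:C * exp_poly b n w * u) <=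
        C * cmod (exp_poly b n w) * (cmod u ^+ 2 + e * cmod u).
    move=> bS Wb near_b.
    have -> : exp_poly b n (w + u) - exp_poly b n w - m%:C * exp_poly b n w * u =
      (exp_poly b n (w + u) - exp_poly b n w - exp_poly (exp_poly_deriv b) n w * u) +
      (exp_poly (exp_poly_deriv b) n w - m%:C * exp_poly b n w) * u by ring.
    apply: le_trans (cmodD_le _ _) _; rewrite cmodM.
    set g0 := cmod (exp_poly b n w) in Wb *.
    have g00 : 0 <= g0 by exact: cmod_ge0.
    have b1 : 10 * (Q ^+ 2 * T) * (W * c) <= C * g0.
      apply: (@le_trans _ _ (10 * (Q ^+ 2 * T) * (4 * g0))).
        by rewrite ler_wpM2l// mulr_ge0.
      by have := ler_wpM2r g00 CT2; clear; lra.
    have b2 : (1 + Q) * T * e * (W * c) <= C * g0 * e.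
      rewrite [leLHS]mulrAC ler_wpM2r ?(ltW e0)//.
      apply: (@le_trans _ _ ((1 + Q) * T * (4 * g0))); first by rewrite ler_wpM2l.
      by have := ler_wpM2r g00 CT; clear; lra.
    rewrite mulrDr lerD//.
      by apply: le_trans (taylor b u bS Cu) _; rewrite ler_wpM2r ?sqr_ge0.
    by rewrite mulrA ler_wpM2r// (le_trans near_b).
  have Wf0 : W * c <= 4 * f0 by clear -f_lb f00; lra.
  have Wf1 : W * c <= 4 * f1 by clear -f_lb f'_lb; lra.
  by move=> g [->|->]; apply: key.
Qed.

End ExponentialPolynomials.

(** * Transversal crossing of the real direction *)

Section Transversality.
Context {R : realType}.
Local Arguments cmod : simpl never.
Implicit Types (z w u a b : R[i]) (s t X alpha l : R).

(* [a] and [b] are values, at times [tau] apart, of a curve with logarithmic derivative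
   close to [m * zeta]; as [zeta] is far from real, the curve crosses the real direction
   with nonzero speed, so the two values are both nearly real only if [tau] is small. *)
Lemma transversal_crossing a b (zeta : R[i]) (m tau mu nu Z beta : R) :
  a != 0 -> 1 <= `|m| -> 0 <= beta -> 8 * beta <= 1 -> 8 * (beta * Z) <= nu -> 4 * mu <= nu ->
  cmod (b - a - m%:C * a * (zeta * tau%:C)) <= mu * (cmod a * `|tau|) ->
  `|complex.Im a| <= beta * cmod a -> `|complex.Im b| <= beta * cmod b ->
  cmod b <= 2 * cmod a -> cmod zeta <= Z -> nu <= `|complex.Im zeta| ->
  nu * `|tau| <= 6 * beta.
Proof.
move=> a0 m1 b0 b1 bZ munu err Ima Imb ba zZ nuz.
have ca : 0 < cmod a by rewrite cmod_gt0.
have nu0 : 0 <= nu.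
  by apply: le_trans bZ; rewrite !mulr_ge0// (le_trans _ zZ)// cmod_ge0.
(* [m * tau * p] is the imaginary part of the main increment [m * a * zeta * tau], so [p] measures
   the crossing speed. *)
set p := complex.Im (a * zeta).
have Imd : `|m * tau * p| <= `|complex.Im (b - a)| + mu * (cmod a * `|tau|).
  have -> : m * tau * p = complex.Im (b - a) -
      complex.Im (b - a - m%:C * a * (zeta * tau%:C)).
    rewrite /p; case: (a) (b) (zeta) => a1 a2 [b1' b2] [z1 z2] /=; ring.
  apply: le_trans (ler_normB _ _) _; rewrite lerD2l.
  by apply: le_trans (Im_le_cmod _) err.
have Imba : `|complex.Im (b - a)| <= 3 * beta * cmod a.
  rewrite ImD ImN; apply: le_trans (ler_normB _ _) _.
  have := ler_wpM2l b0 ba; lra.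
have Rea : (1 - beta) * cmod a <= `|complex.Re a|.
  by have := cmod_le_ReIm a; lra.
(* As [a] is nearly real, [p] is close to [Re a * Im zeta]. *)
have pl : nu * (cmod a * (3 / 4)) <= `|p|.
  have h1 : `|complex.Re a * complex.Im zeta| <= `|p| + `|complex.Im a * complex.Re zeta|.
    have -> : complex.Re a * complex.Im zeta = p - complex.Im a * complex.Re zeta.
      by rewrite /p ImM; ring.
    exact: ler_normB.
  have h2 : `|complex.Im a * complex.Re zeta| <= cmod a * (nu / 8).
    rewrite normrM; apply: le_trans (ler_pM _ _ Ima (le_trans (Re_le_cmod _) zZ)) _ => //.
    have := ler_wpM2l (ltW ca) bZ; lra.
  have h3 : (7 / 8 * cmod a) * nu <= `|complex.Re a * complex.Im zeta|.
    rewrite normrM; apply: ler_pM => //; first by rewrite mulr_ge0// ltW.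
    by apply: le_trans Rea; rewrite ler_wpM2r ?(ltW ca)//; lra.
  lra.
have tp : `|tau| * (nu * (cmod a * (3 / 4))) <= `|m * tau * p|.
  rewrite -mulrA normrM (le_trans (ler_wpM2l (normr_ge0 _) pl))// -[leLHS]mul1r.
  by rewrite normrM ler_wpM2r// mulr_ge0.
have mut : mu * (cmod a * `|tau|) <= nu / 4 * (cmod a * `|tau|).
  by rewrite ler_wpM2r ?mulr_ge0 ?(ltW ca)//; lra.
rewrite -(ler_pM2r ca); lra.
Qed.

End Transversality.

(** * Tame curves and their images under [f] *)

Section Curves.
Context {R : realType}.
Local Arguments cmod : simpl never.
Variables (f f' : R[i] -> R[i]) (C X0 : R).
Hypotheses (C200 : 200 <= C) (fexp : exp_like f f' C X0).
Implicit Types (z w u : R[i]) (s t X alpha l : R) (gamma zeta : R -> R[i]).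

Let e : R := C^-1.

(* [zeta] plays the role of the derivative of the curve [gamma] on [[alpha, alpha + l]];
   the image has length about [1 / X], is nearly straight, and is not nearly horizontal. *)
Record tame X alpha l gamma zeta : Prop := Tame {
  tame_pos : 0 < cmod (zeta alpha) ;
  tame_Re t : alpha <= t <= alpha + l -> X <= `|complex.Re (gamma t)| ;
  tame_deriv s t : alpha <= s <= alpha + l -> alpha <= t <= alpha + l ->
    cmod (gamma t - gamma s - zeta s * (t - s)%:C) <=
      cmod (zeta alpha) ^+ 2 / (C * X) * (t - s) ^+ 2 ;
  tame_lip s t : alpha <= s <= alpha + l -> alpha <= t <= alpha + l ->
    cmod (zeta t - zeta s) <= cmod (zeta alpha) ^+ 2 / (C * X) * `|t - s| ;
  tame_Im : cmod (zeta alpha) <= X * `|complex.Im (zeta alpha)| ;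
  tame_len_le : C ^+ 2 * X * l * cmod (zeta alpha) <= 1 ;
  tame_len_ge : 1 <= 8 * C ^+ 2 * X * l * cmod (zeta alpha) }.

(** [expR (X / 2)] is the distance from the axis wanted after the next step; the last condition lets
    it absorb the constants and powers of [X] lost in that step. *)
Definition large X :=
  [/\ X0 <= X, 4 <= X & C ^+ 3 * X ^+ 4 <= expR (X / 2)].

Section Tame.
Variables (X alpha l : R) (gamma zeta : R -> R[i]).
Hypotheses (lX : large X) (T : tame X alpha l gamma zeta).

Let J t := alpha <= t <= alpha + l.
Let z0 := cmod (zeta alpha).
Let d := X^-1.

Let X4 : 4 <= X. Proof. by case: lX. Qed.
Let Xgt0 : 0 < X. Proof. by move: X4; lra. Qed.
Let d0 : 0 < d. Proof. by rewrite invr_gt0. Qed.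
Let dX : d * X = 1. Proof. by rewrite mulVf ?gt_eqF. Qed.
Let d4 : d <= 1 / 4. Proof. by rewrite /d -div1r ler_pdivrMr//; move: X4; lra. Qed.
Let z00 : 0 < z0. Proof. exact: tame_pos T. Qed.
Let C0 : 0 < C. Proof. by move: C200; lra. Qed.
Let e0 : 0 < e. Proof. by rewrite invr_gt0. Qed.
Let eC : e * C = 1. Proof. by rewrite mulVf ?gt_eqF. Qed.
Let e200 : e <= 1 / 200. Proof. by rewrite /e -div1r ler_pdivrMr//; move: C200; lra. Qed.
Let basics : [/\ 200 <= C, 4 <= X, d <= 1 / 4 & e <= 1 / 200] /\
  [/\ 0 < d, 0 < z0, 0 < e, d * X = 1 & e * C = 1].
Proof. by []. Qed.
Let kE : z0 ^+ 2 / (C * X) = e * d * z0 ^+ 2.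
Proof. by rewrite invfM /d /e; ring. Qed.
Let l0 : 0 < l.
Proof.
have /(lt_le_trans ltr01) := tame_len_ge T.
by rewrite pmulr_lgt0 ?(tame_pos T)// pmulr_rgt0// mulr_gt0// mulr_gt0// exprn_gt0.
Qed.
Let lzC : C * (l * z0) <= e * d.
Proof.
have := ler_wpM2l (ltW (mulr_gt0 e0 d0)) (tame_len_le T).
have -> : e * d * (C ^+ 2 * X * l * cmod (zeta alpha)) = (e * C) * (d * X) * (C * (l * z0)).
  by rewrite /z0; ring.
by rewrite dX eC !mulr1 !mul1r.
Qed.
Let lz1 : l * z0 <= e * d.
Proof.
apply: le_trans lzC; rewrite ler_peMl// ?mulr_ge0 ?ltW//; move: C200; lra.
Qed.
Let ed : e * d <= 1 / 800.
Proof. have : e * d <= 1 / 200 * (1 / 4) by rewrite ler_pM// ltW. lra. Qed.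
Let Ja : J alpha. Proof. by rewrite /J lexx lerDl ltW. Qed.
Let Jdist s t : J s -> J t -> `|t - s| <= l.
Proof. by rewrite /J ler_norml => /andP[? ?] /andP[? ?]; apply/andP; split; lra. Qed.

(** The Lipschitz constant [e * d * z0 ^+ 2] times the length is tiny even against [d * z0], the
    guaranteed size of [|Im (zeta alpha)|]. So neither speed nor slope degenerates along the
    curve. *)
Lemma tame_deriv_near s : J s -> cmod (zeta s - zeta alpha) <= d * z0 / 200.
Proof.
have [[bC bX bd be] [bd0 bz be0 bdX beC]] := basics.
move=> Js; apply: le_trans (tame_lip T Ja Js) _; rewrite -/z0 kE.
have p1 : z0 * `|s - alpha| <= 1 / 800.
  have := ler_wpM2l (ltW bz) (Jdist Ja Js); move: lz1 ed; lra.
have p2 := ler_wpM2l (mulr_ge0 (ltW d0) (ltW bz)) (ler_pM (ltW be0) (mulr_ge0 (ltW bz) (normr_ge0 _)) be p1).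
have := mulr_ge0 (ltW d0) (ltW bz); lra.
Qed.

Lemma tame_deriv_bounds s : J s ->
  [/\ 7 / 8 * z0 <= cmod (zeta s), cmod (zeta s) <= 9 / 8 * z0 &
      7 / 8 * (d * z0) <= `|complex.Im (zeta s)|].
Proof.
have [[bC bX bd be] [bd0 bz be0 bdX beC]] := basics.
move=> Js; have h := tame_deriv_near Js.
have dz : d * z0 <= z0 / 4 by have := ler_wpM2r (ltW z00) d4; lra.
have h1 := cmod_leD (zeta s) (zeta alpha).
have h2 := cmod_leD (zeta alpha) (zeta s).
rewrite cmod_distC in h2.
split; [rewrite /z0 in h dz *; lra..|].
have h3 : `|complex.Im (zeta alpha)| <= `|complex.Im (zeta s)| + cmod (zeta s - zeta alpha).
  have -> : complex.Im (zeta alpha) = complex.Im (zeta s) - complex.Im (zeta s - zeta alpha).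
    by rewrite ImD ImN; ring.
  apply: le_trans (ler_normB _ _) _; rewrite lerD2l; exact: Im_le_cmod.
have h4 : d * z0 <= `|complex.Im (zeta alpha)|.
  have := ler_wpM2l (ltW d0) (tame_Im T).
  by rewrite mulrA dX mul1r.
have := mulr_ge0 (ltW d0) (ltW z00); lra.
Qed.

Lemma tame_dist s t : J s -> J t -> cmod (gamma t - gamma s) <= 2 * z0 * `|t - s|.
Proof.
have [[bC bX bd be] [bd0 bz be0 bdX beC]] := basics.
move=> Js Jt; have [_ zs _] := tame_deriv_bounds Js.
apply: le_trans (cmod_leD _ (zeta s * (t - s)%:C)) _.
rewrite cmodM cmod_real.
have := tame_deriv T Js Jt; rewrite -/z0 kE -(@real_normK _ (t - s)) ?num_real//.
have := Jdist Js Jt; pose q : R := `|t - s|; rewrite -/q => ql h.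
have q0 : 0 <= q := normr_ge0 _.
have h1 := ler_wpM2r q0 zs.
have e2 : z0 * q <= 1 / 800.
  have := ler_wpM2l (ltW bz) ql; move: lz1 ed; lra.
have zq := mulr_ge0 (ltW bz) q0.
have h2 := ler_wpM2r zq (ler_pM (ltW (mulr_gt0 be0 bd0)) zq ed e2).
move: h h1; lra.
Qed.

Lemma tame_dist_small s t : J s -> J t -> C * cmod (gamma t - gamma s) <= 2 * (e * d).
Proof.
have [[bC bX bd be] [bd0 bz be0 bdX beC]] := basics.
move=> Js Jt; apply: le_trans (ler_wpM2l (ltW C0) (tame_dist Js Jt)) _.
have zl : z0 * `|t - s| <= z0 * l by rewrite ler_wpM2l ?Jdist// ltW.
have := ler_wpM2l (ltW C0) zl; have := lzC; lra.
Qed.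

Let X0Re s : J s -> X0 <= `|complex.Re (gamma s)|.
Proof. by move=> Js; apply: le_trans (tame_Re T Js); case: lX. Qed.

Let XRe s : J s -> X <= `|complex.Re (gamma s)|.
Proof. by move=> Js; have := tame_Re T Js. Qed.
Let expX_sq : expR X = expR (X / 2) * expR (X / 2).
Proof. by rewrite -expRD -splitr. Qed.
Let expX : C ^+ 2 * X <= expR X.
Proof.
have [[bC bX bd be] [bd0 bz be0 bdX beC]] := basics.
have X1 : 1 <= X by lra.
have CC1 : 1 <= C by lra.
case: lX => _ _ h; have h1 := expR_ge1Dx (X / 2).
rewrite expX_sq -[leLHS]mulr1; apply: ler_pM => //; last by lra.
  by rewrite mulr_ge0 ?exprn_ge0// ltW.
apply: le_trans h; apply: ler_pM; rewrite ?exprn_ge0 ?(ltW C0) ?(ltW Xgt0)//.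
  exact: ler_weXn2l.
by rewrite -{1}[X]expr1; exact: ler_weXn2l.
Qed.

(** Chain rule with the logarithmic derivative [m] of [g]. The quadratic remainder, the
    exponentially small term and the bending of [gamma] contribute at most [7 * e * d * z0] in all,
    and [e <= 1 / 200]. The error has to stay well below the lower bound for [|Im (zeta s)|], which
    is of order [d * z0]. *)
Lemma tame_compose_increment g s t : g = f \/ g = f' -> J s -> J t ->
  exists m : R, 1 <= `|m| <= C /\
  cmod (g (gamma t) - g (gamma s) - m%:C * g (gamma s) * (zeta s * (t - s)%:C)) <=
    d * z0 / 25 * (cmod (g (gamma s)) * `|t - s|).
Proof.
have [[bC bX bd be] [bd0 bz be0 bdX beC]] := basics.
move=> gE Js Jt.
have [m [mC hm]] := exp_like_exponent fexp (X0Re Js).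
exists m; split => //; set u := gamma t - gamma s; set tau := (t - s)%:C.
have small : C * cmod u <= 2 * (e * d) by exact: tame_dist_small.
have /hm/(_ g gE) : C * cmod u <= 1 by move: ed; lra.
rewrite [gamma s + u]addrC subrK.
set G := g (gamma s); pose x : R := `|complex.Re (gamma s)|; rewrite -/x => h.
have -> : g (gamma t) - G - m%:C * G * (zeta s * tau) =
  (g (gamma t) - G - m%:C * G * u) + m%:C * G * (u - zeta s * tau) by ring.
apply: le_trans (cmodD_le _ _) _; rewrite [cmod (m%:C * G * _)]cmodM [cmod (_ * G)]cmodM.
rewrite cmod_real.
have := tame_deriv T Js Jt; rewrite -/z0 kE -(@real_normK _ (t - s)) ?num_real//.
have ud := tame_dist Js Jt.
have := Jdist Js Jt; pose q : R := `|t - s|; move: ud h; rewrite -/u -/tau -/q.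
have q0 : 0 <= q := normr_ge0 _.
have G0 := cmod_ge0 G; have u0 := cmod_ge0 u.
move=> ud h ql h2.
have ex : C * expR (- x) <= e * d.
  have Xx : X <= x by exact: XRe.
  have : expR (- x) <= expR (- X) by rewrite ler_expR lerN2.
  move/(ler_wpM2l (ltW C0))/le_trans; apply; rewrite expRN ler_pdivrMr ?expR_gt0//.
  have := ler_wpM2l (ltW (mulr_gt0 be0 d0)) expX.
  have -> : e * d * (C ^+ 2 * X) = (e * C) * (d * X) * C by ring.
  by rewrite dX eC !mul1r.
have p1 : C * cmod G * (cmod u ^+ 2 + expR (- x) * cmod u) <=
    cmod G * (3 * (e * d)) * (2 * z0 * q).
  have -> : C * cmod G * (cmod u ^+ 2 + expR (- x) * cmod u) =
    cmod G * (C * cmod u + C * expR (- x)) * cmod u by ring.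
  apply: ler_pM => //; last by rewrite ler_wpM2l//; lra.
  by rewrite mulr_ge0// addr_ge0// mulr_ge0 ?(ltW C0)// ltW// expR_gt0.
have p2 : `|m| * cmod G * cmod (u - zeta s * tau) <= C * cmod G * (e * d * z0 ^+ 2 * q ^+ 2).
  apply: ler_pM => //; rewrite ?mulr_ge0 ?cmod_ge0//.
  by rewrite ler_wpM2r//; case/andP: mC.
have p3 : C * cmod G * (e * d * z0 ^+ 2 * q ^+ 2) <= cmod G * q * (d * z0 * (e * d)).
  have -> : C * cmod G * (e * d * z0 ^+ 2 * q ^+ 2) =
     (cmod G * q) * (d * z0 * ((e * C) * (q * z0))) by ring.
  apply: ler_wpM2l; first by rewrite mulr_ge0.
  apply: ler_wpM2l; first by rewrite mulr_ge0 ?ltW.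
  by rewrite eC mul1r; apply: le_trans lz1; rewrite ler_wpM2r// ltW.
have Gz := mulr_ge0 (mulr_ge0 G0 q0) (mulr_ge0 (ltW d0) (ltW bz)).
have p4 : cmod G * q * (d * z0) * (e * d) <= cmod G * q * (d * z0) * e.
  by rewrite ler_wpM2l// ler_piMr ?(ltW be0)//; lra.
have p5 := ler_wpM2l Gz be.
move: (le_trans p2 p3) (le_trans h p1); lra.
Qed.

Lemma tame_compose_lip g s t : g = f \/ g = f' -> J s -> J t ->
  cmod (g (gamma t) - g (gamma s)) <= 5 / 4 * C * z0 * (cmod (g (gamma s)) * `|t - s|).
Proof.
have [[bC bX bd be] [bd0 bz be0 bdX beC]] := basics.
move=> gE Js Jt; have [m [/andP[_ mC] h]] := tame_compose_increment gE Js Jt.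
have [_ zs _] := tame_deriv_bounds Js.
apply: le_trans (cmod_leD _ (m%:C * g (gamma s) * (zeta s * (t - s)%:C))) _.
rewrite !cmodM !cmod_real.
pose G : R := cmod (g (gamma s)); pose q : R := `|t - s|; rewrite -/G -/q in h *.
have G0 : 0 <= G := cmod_ge0 _; have q0 : 0 <= q := normr_ge0 _.
have Gq0 := mulr_ge0 G0 q0.
have p : `|m| * cmod (zeta s) <= C * (9 / 8 * z0) by apply: ler_pM; rewrite ?cmod_ge0.
have p1 := ler_wpM2r Gq0 p.
have p2 : d * z0 / 25 * (G * q) <= C * z0 / 100 * (G * q).
  rewrite ler_wpM2r//; have := ler_wpM2r (ltW z00) d4; have := ler_wpM2r (ltW z00) bC; lra.
have : 0 <= C * z0 * (G * q) by rewrite mulr_ge0// mulr_ge0 ?ltW.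
lra.
Qed.

Lemma tame_compose_ratio g s t : g = f \/ g = f' -> J s -> J t ->
  cmod (g (gamma t)) <= 5 / 4 * cmod (g (gamma s)).
Proof.
have [[bC bX bd be] [bd0 bz be0 bdX beC]] := basics.
move=> gE Js Jt; have h := tame_compose_lip gE Js Jt.
apply: le_trans (cmod_leD _ (g (gamma s))) _.
pose G : R := cmod (g (gamma s)); rewrite -/G in h *; have G0 : 0 <= G := cmod_ge0 _.
have zl : z0 * `|t - s| <= l * z0 by rewrite mulrC ler_wpM2r ?Jdist// ltW.
have e2 : C * (z0 * `|t - s|) <= 1 / 100.
  by have := ler_wpM2l (ltW C0) zl; have := lzC; have := ed; lra.
have := ler_wpM2r G0 e2; lra.
Qed.

(** The velocity of the image curve [f \o gamma], by the chain rule. *)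
Let G t := f' (gamma t) * zeta t.

Lemma tame_velocity_ratio s t : J s -> J t -> cmod (G t) <= 2 * cmod (G s).
Proof.
have [[bC bX bd be] [bd0 bz be0 bdX beC]] := basics.
move=> Js Jt; rewrite !cmodM.
have h := tame_compose_ratio (or_intror (erefl f')) Js Jt.
have [_ z2 _] := tame_deriv_bounds Jt; have [z1 _ _] := tame_deriv_bounds Js.
have p := ler_pM (cmod_ge0 _) (cmod_ge0 _) h z2.
have := ler_wpM2l (cmod_ge0 (f' (gamma s))) z1.
have := mulr_ge0 (cmod_ge0 (f' (gamma s))) (ltW z00).
lra.
Qed.

(** Product rule: [zeta] varies so slowly that it only adds to the error, and the logarithmic
    derivative of [f'] gives [m * zeta s] again. *)
Lemma tame_velocity_increment s t : J s -> J t ->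
  exists m : R, 1 <= `|m| <= C /\
  cmod (G t - G s - m%:C * G s * (zeta s * (t - s)%:C)) <=
    d * z0 / 10 * (cmod (G s) * `|t - s|).
Proof.
have [[bC bX bd be] [bd0 bz be0 bdX beC]] := basics.
move=> Js Jt; have fE := or_intror (erefl f') : f' = f \/ f' = f'.
have [m [mC h]] := tame_compose_increment fE Js Jt.
exists m; split => //; rewrite /G.
have -> : f' (gamma t) * zeta t - f' (gamma s) * zeta s -
    m%:C * (f' (gamma s) * zeta s) * (zeta s * (t - s)%:C) =
  (f' (gamma t) - f' (gamma s) - m%:C * f' (gamma s) * (zeta s * (t - s)%:C)) * zeta s +
  f' (gamma t) * (zeta t - zeta s) by ring.
apply: le_trans (cmodD_le _ _) _; rewrite 2!cmodM.
have [z1 _ _] := tame_deriv_bounds Js.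
have := tame_lip T Js Jt; rewrite -/z0 kE => h2.
have h3 := tame_compose_ratio fE Js Jt.
rewrite [cmod (f' _ * zeta s)]cmodM.
pose q : R := `|t - s|; pose F : R := cmod (f' (gamma s)); rewrite -/q -/F in h h2 h3 *.
have q0 : 0 <= q := normr_ge0 _; have F0 : 0 <= F := cmod_ge0 _.
have p1 := ler_wpM2r (cmod_ge0 (zeta s)) h.
have p2 := ler_pM (cmod_ge0 _) (cmod_ge0 _) h3 h2.
have Fq : 0 <= F * q * (d * z0) by rewrite !mulr_ge0// ltW.
have p3 := ler_wpM2l Fq z1.
have p4 := ler_wpM2l (mulr_ge0 Fq (ltW bz)) be.
have p5 := mulr_ge0 Fq (ltW bz).
move: p1 p2 p3 p4; lra.
Qed.

(* The times at which the next iterate is too close to the imaginary axis, and those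
   at which the image curve is too close to horizontal. *)
Definition exc_Re t := J t /\ `|complex.Re (f (gamma t))| < d ^+ 4 * cmod (f (gamma t)).
Definition exc_Im t := J t /\ `|complex.Im (G t)| < d ^+ 4 * cmod (G t).

Let d4le : d ^+ 4 <= d / 64.
Proof.
have [[bC bX bd be] [bd0 bz be0 bdX beC]] := basics.
have -> : d ^+ 4 = d * (d * d * d) by ring.
have h := ler_pM (ltW d0) (ltW d0) d4 d4.
have h2 := ler_pM (mulr_ge0 (ltW d0) (ltW d0)) (ltW d0) h d4.
have := ler_wpM2l (ltW d0) h2; lra.
Qed.

(** Division by [7 / 8 * d] turns [d ^+ 4] into [d ^+ 3], and [6 / (7 / 8)] is below [7]. *)
Let sep_conclude (tau : R) : 7 / 8 * (d * z0) * `|tau| <= 6 * d ^+ 4 ->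
  `|tau| <= 7 * d ^+ 3 / z0.
Proof.
have [[bC bX bd be] [bd0 bz be0 bdX beC]] := basics.
move=> h; rewrite ler_pdivlMr//.
rewrite [d ^+ 4]exprS in h; rewrite -(ler_pM2l d0); have := exprn_ge0 3 (ltW d0) => /(mulr_ge0 (ltW d0)).
lra.
Qed.

Let fneq0 s : J s -> f (gamma s) != 0.
Proof.
have [[bC bX bd be] [bd0 bz be0 bdX beC]] := basics.
move=> Js; rewrite -cmod_gt0 -(pmulr_rgt0 _ C0).
exact: lt_le_trans (expR_gt0 _) (exp_like_large fexp (X0Re Js)).
Qed.

Let f'neq0 s : J s -> f' (gamma s) != 0.
Proof.
have [[bC bX bd be] [bd0 bz be0 bdX beC]] := basics.
move=> Js; rewrite -cmod_gt0; have := exp_like_le_deriv fexp (X0Re Js).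
by have := fneq0 Js; rewrite -cmod_gt0; lra.
Qed.

(** Multiplication by ['i] turns values near the imaginary axis into nearly real ones, so
    [transversal_crossing] applies with [beta = d ^+ 4]. *)
Lemma exc_Re_sep s t : exc_Re s -> exc_Re t -> `|t - s| <= 7 * d ^+ 3 / z0.
Proof.
have [[bC bX bd be] [bd0 bz be0 bdX beC]] := basics.
move=> [Js hs] [Jt ht]; apply: sep_conclude.
have fE := or_introl (erefl f) : f = f \/ f = f'.
have [m [/andP[m1 _] h]] := tame_compose_increment fE Js Jt.
have [z1 z2 z3] := tame_deriv_bounds Js.
have ci : cmod ('i : R[i]) = 1 by rewrite /cmod/= expr0n expr1n add0r sqrtr1.
have ImI z : complex.Im ('i * z) = complex.Re z by rewrite ImM /= mul0r mul1r add0r.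
have dz := mulr_ge0 (ltW d0) (ltW z00).
apply: (@transversal_crossing R ('i * f (gamma s)) ('i * f (gamma t)) (zeta s) m (t - s)
  (d * z0 / 25) (7 / 8 * (d * z0)) (9 / 8 * z0) (d ^+ 4)) => //.
- by rewrite mulf_neq0 ?fneq0// -cmod_gt0 ci.
- by rewrite exprn_ge0 ?ltW.
- by move: d4le; lra.
- have := ler_wpM2r (ltW z00) d4le; lra.
- lra.
- have -> : 'i * f (gamma t) - 'i * f (gamma s) - m%:C * ('i * f (gamma s)) *
     (zeta s * (t - s)%:C) = 'i * (f (gamma t) - f (gamma s) - m%:C * f (gamma s) *
     (zeta s * (t - s)%:C)) by ring.
  by rewrite [cmod ('i * (_ - _))]cmodM [cmod ('i * f _)]cmodM ci !mul1r.
- by rewrite ImI cmodM ci mul1r ltW.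
- by rewrite ImI cmodM ci mul1r ltW.
- rewrite !cmodM ci !mul1r; have := tame_compose_ratio fE Js Jt.
  by have := cmod_ge0 (f (gamma s)); lra.
Qed.

Lemma exc_Im_sep s t : exc_Im s -> exc_Im t -> `|t - s| <= 7 * d ^+ 3 / z0.
Proof.
have [[bC bX bd be] [bd0 bz be0 bdX beC]] := basics.
move=> [Js hs] [Jt ht]; apply: sep_conclude.
have [m [/andP[m1 _] h]] := tame_velocity_increment Js Jt.
have [z1 z2 z3] := tame_deriv_bounds Js.
have dz := mulr_ge0 (ltW d0) (ltW z00).
apply: (@transversal_crossing R (G s) (G t) (zeta s) m (t - s)
  (d * z0 / 10) (7 / 8 * (d * z0)) (9 / 8 * z0) (d ^+ 4)) => //.
- rewrite mulf_neq0 ?f'neq0// -cmod_gt0; lra.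
- by rewrite exprn_ge0 ?ltW.
- by move: d4le; lra.
- have := ler_wpM2r (ltW z00) d4le; lra.
- lra.
- exact: ltW.
- exact: ltW.
- exact: tame_velocity_ratio.
Qed.

(** Half of the exponent in [expR X <= 2 * C * cmod (f' (gamma s))] pays for [C ^+ 3 * X ^+ 4]. *)
Lemma tame_deriv_large s : J s -> expR (X / 2) * (C ^+ 2 * X ^+ 4) <= 2 * cmod (f' (gamma s)).
Proof.
have [[bC bX bd be] [bd0 bz be0 bdX beC]] := basics.
move=> Js.
have h1 := exp_like_large fexp (X0Re Js).
have h2 := exp_like_le_deriv fexp (X0Re Js).
have h3 : expR X <= expR `|complex.Re (gamma s)| by rewrite ler_expR; exact: XRe.
have h4 : expR X <= C * (2 * cmod (f' (gamma s))).
  by have := ler_wpM2l (ltW C0) h2; lra.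
case: lX => _ _ h.
have h5 := ler_wpM2l (expR_ge0 (X / 2)) h.
rewrite -(ler_pM2l C0); apply: le_trans h4; rewrite expX_sq; apply: le_trans h5.
by rewrite le_eqVlt; apply/orP; left; apply/eqP; ring.
Qed.

(** With [r = |Re (gamma t)|], one of the two factors [expR (r / 2)] of [expR r] pays for the loss
    of [d ^+ 4 / C]. *)
Lemma not_exc_Re_good t : J t -> ~ exc_Re t ->
  expR (`|complex.Re (gamma t)| / 2) <= `|complex.Re (f (gamma t))|.
Proof.
have [[bC bX bd be] [bd0 bz be0 bdX beC]] := basics.
move=> Jt nexc; have : d ^+ 4 * cmod (f (gamma t)) <= `|complex.Re (f (gamma t))|.
  by rewrite leNgt; apply/negP => h; apply: nexc.
apply: le_trans.
have h1 := exp_like_large fexp (X0Re Jt).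
pose r : R := `|complex.Re (gamma t)|; rewrite -/r in h1 *.
have Xr : X <= r by exact: XRe.
have er : expR r = expR (r / 2) * expR (r / 2) by rewrite -expRD -splitr.
have h2 : expR (X / 2) <= expR (r / 2) by rewrite ler_expR; lra.
case: lX => _ _ h.
have X40 : 0 <= X ^+ 4 by rewrite exprn_ge0// ltW.
have CX : C * X ^+ 4 <= expR (r / 2).
  apply: le_trans h2; apply: le_trans h; rewrite ler_wpM2r//.
  by rewrite -{1}[C]expr1; apply: ler_weXn2l => //; lra.
have dX4 : d ^+ 4 * X ^+ 4 = 1 by rewrite -exprMn dX expr1n.
rewrite -(ler_pM2l C0).
have := ler_wpM2l (exprn_ge0 4 (ltW d0)) h1.
rewrite er => h5.
have h6 := ler_wpM2l (exprn_ge0 4 (ltW d0)) (ler_wpM2r (expR_ge0 (r / 2)) CX).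
have e6 : d ^+ 4 * (C * X ^+ 4 * expR (r / 2)) = (d ^+ 4 * X ^+ 4) * (C * expR (r / 2)) by ring.
rewrite e6 dX4 mul1r in h6; lra.
Qed.

(** The tolerances in [tame] grow with the square of the initial speed, the nonlinearity produced by
    [f] only linearly, so expansion by [f'] helps. The length conditions refer to [G alpha], so that
    one length [s] serves all pieces of an arc; passing to [G alpha1] costs a factor [2] each
    way. *)
Lemma tame_image alpha1 s : 0 <= s -> alpha <= alpha1 -> alpha1 + s <= alpha + l ->
  (forall t, alpha1 <= t <= alpha1 + s -> ~ exc_Re t) -> ~ exc_Im alpha1 ->
  2 * (C ^+ 2 * expR (X / 2) * s * cmod (G alpha)) <= 1 ->
  1 <= 4 * (C ^+ 2 * expR (X / 2) * s * cmod (G alpha)) ->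
  tame (expR (X / 2)) alpha1 s (f \o gamma) G.
Proof.
have [[bC bX bd be] [bd0 bz be0 bdX beC]] := basics.
move=> s0 aa1 a1s nRe nIm len1 len2.
have sub t : alpha1 <= t <= alpha1 + s -> J t.
  by rewrite /J => /andP[? ?]; apply/andP; split; lra.
have J1 : J alpha1 by apply: sub; rewrite lexx lerDl.
set X' := expR (X / 2); have X'0 : 0 < X' by exact: expR_gt0.
set z1 := cmod (G alpha1).
have r1 := tame_velocity_ratio Ja J1; have r2 := tame_velocity_ratio J1 Ja.
rewrite -/z1 in r1 r2.
have X's0 : 0 <= X' * s by rewrite mulr_ge0// ltW.
have z10 : 0 < z1.
  have := f'neq0 J1; rewrite /z1 cmodM -cmod_gt0 => h; apply: mulr_gt0 => //.
  have [h1 _ _] := tame_deriv_bounds J1; lra.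
(* The new speed [z1] exceeds the old one [z0] by a factor [40 * (C ^+ 2 * X')]; hence the new
   tolerance [k] is at least [40 * (C * z0 * z1)]. *)
have key t : J t -> 40 * (C ^+ 2 * X') * z0 <= z1.
  move=> Jt; have h := tame_deriv_large Jt; have [h1 _ _] := tame_deriv_bounds Jt.
  have h2 := tame_velocity_ratio J1 Jt; rewrite -/z1 /G cmodM in h2.
  have X41 : 4 ^+ 4 <= X ^+ 4 by rewrite lerXn2r ?nnegrE//; lra.
  have X42 : 4 ^+ 4 = 256 :> R by ring.
  have C2 : 0 <= X' * C ^+ 2 by rewrite mulr_ge0 ?exprn_ge0 ?ltW.
  have h3 : 128 * (X' * C ^+ 2) <= cmod (f' (gamma t)).
    rewrite -/X' in h; have := ler_wpM2l C2 X41; rewrite X42; lra.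
  have h4 : 128 * (X' * C ^+ 2) * (7 / 8 * z0) <= 2 * z1.
    apply: le_trans h2; apply: ler_pM => //; rewrite ?mulr_ge0// ltW//.
  have := mulr_ge0 C2 (ltW z00); lra.
set k := z1 ^+ 2 / (C * X').
have kz : 40 * (C * z0 * z1) <= k.
  rewrite ler_pdivlMr ?mulr_gt0//; have := ler_wpM2l (ltW z10) (key _ J1).
  by rewrite expr2; lra.
have Cz1 : 0 <= C * z0 * z1 by rewrite !mulr_ge0 ?ltW.
have dz1 : d * z0 <= z0 / 4 by have := ler_wpM2r (ltW bz) bd; lra.
have Cz : z0 <= C * z0 by rewrite ler_peMl ?ltW//; lra.
split.
- exact: z10.
- move=> t tI /=; apply: le_trans (not_exc_Re_good (sub t tI) (nRe t tI)).
  by rewrite ler_expR ler_wpM2r//; exact: XRe (sub t tI).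
- move=> s' t /sub Js' /sub Jt /=; rewrite -/z1 -/k.
  pose u := gamma t - gamma s'; pose F : R := cmod (f' (gamma s')).
  (* The Taylor remainder of [f] at the displacement [u], plus the bending of [gamma] transported by
     [f']. *)
  have -> : f (gamma t) - f (gamma s') - G s' * (t - s')%:C =
    (f (gamma t) - f (gamma s') - f' (gamma s') * u) +
    f' (gamma s') * (u - zeta s' * (t - s')%:C) by rewrite /G; ring.
  apply: le_trans (cmodD_le _ _) _; rewrite [cmod (f' _ * (_ - _))]cmodM -/F.
  have small : C * cmod u <= 1 by have := tame_dist_small Js' Jt; rewrite -/u; move: ed; lra.
  have h1 := exp_like_taylor fexp (X0Re Js') small.
  have ut : gamma s' + u = gamma t by rewrite /u addrC subrK.
  rewrite ut in h1.
  have h2 := exp_like_le_deriv fexp (X0Re Js'); rewrite -/F in h2.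
  have h3 := tame_dist Js' Jt; rewrite -/u in h3.
  have h4 := tame_deriv T Js' Jt.
  rewrite -/z0 kE -/u -(@real_normK _ (t - s')) ?num_real// in h4.
  rewrite -(@real_normK _ (t - s')) ?num_real//.
  pose q : R := `|t - s'|; rewrite -/q in h3 h4 *.
  have q0 : 0 <= q := normr_ge0 _; have F0 : 0 <= F := cmod_ge0 _.
  have u2 : cmod u ^+ 2 <= (2 * z0 * q) ^+ 2.
    by rewrite ler_sqr ?nnegrE ?cmod_ge0// !mulr_ge0// ltW.
  have g1 : C * cmod (f (gamma s')) * cmod u ^+ 2 <= C * (2 * F) * (2 * z0 * q) ^+ 2.
    by apply: ler_pM => //; rewrite ?mulr_ge0 ?sqr_ge0 ?cmod_ge0 ?(ltW C0)// ler_wpM2l// ltW.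
  have g2 := ler_wpM2l F0 h4.
  have Fz : 7 / 8 * (F * z0) <= 2 * z1.
    have := tame_velocity_ratio J1 Js'; rewrite -/z1 /G cmodM -/F.
    have [b1 _ _] := tame_deriv_bounds Js'; have := ler_wpM2l F0 b1; lra.
  have Cz0 : 0 <= C * z0 by rewrite mulr_ge0 ?ltW.
  have g3 := ler_wpM2l Cz0 Fz.
  have g4 : 9 * (C * z0 * (F * z0)) <= k by lra.
  have g5 := ler_wpM2r (sqr_ge0 q) g4.
  have g6 : F * (e * d * z0 ^+ 2 * q ^+ 2) <= C * z0 * (F * z0) * q ^+ 2.
    have -> : F * (e * d * z0 ^+ 2 * q ^+ 2) = e * d * z0 * (F * z0) * q ^+ 2 by ring.
    rewrite ler_wpM2r ?sqr_ge0// ler_wpM2r ?mulr_ge0 ?(ltW bz)// ler_wpM2r ?(ltW bz)//.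
    by move: ed; lra.
  move: h1 g1 g2 g5 g6; lra.
- move=> s' t /sub Js' /sub Jt /=; rewrite -/z1 -/k.
  have [m [/andP[_ mC] h]] := tame_velocity_increment Js' Jt.
  have [_ zs _] := tame_deriv_bounds Js'.
  apply: le_trans (cmod_leD _ (m%:C * G s' * (zeta s' * (t - s')%:C))) _.
  rewrite !cmodM !cmod_real -[cmod (f' _) * cmod (zeta _)]cmodM.
  have h1 := tame_velocity_ratio J1 Js'; rewrite -/z1 in h1.
  move: h h1; rewrite /G; pose g : R := cmod (f' (gamma s') * zeta s').
  pose q : R := `|t - s'|; rewrite -/q -/g => h h1.
  have q0 : 0 <= q := normr_ge0 _; have g0 : 0 <= g := cmod_ge0 _.
  have h2 := ler_wpM2r (mulr_ge0 g0 q0) (ler_pM (normr_ge0 m) (cmod_ge0 _) mC zs).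
  have h3 := ler_wpM2r (mulr_ge0 g0 q0) dz1.
  have h4 := ler_wpM2r (mulr_ge0 g0 q0) Cz.
  have h5 : 2 * (C * z0) * (g * q) <= k * q.
    rewrite mulrA ler_wpM2r//; apply: le_trans kz.
    have := ler_wpM2l (mulr_ge0 (ltW C0) (ltW bz)) h1; lra.
  have h6 := mulr_ge0 (mulr_ge0 (ltW C0) (ltW bz)) (mulr_ge0 g0 q0).
  move: h h2 h3 h4 h5 h6; lra.
(* [X ^+ 4 <= X'] turns the threshold [d ^+ 4] of [exc_Im] into the slope [1 / X'] required of the
   new curve. *)
- rewrite -/z1; have X4X' : X ^+ 4 <= X'.
    case: lX => _ _; apply: le_trans; rewrite ler_peMl ?exprn_ge0 ?(ltW Xgt0)//.
    by rewrite exprn_ege1//; lra.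
  have dX4 : d ^+ 4 * X ^+ 4 = 1 by rewrite -exprMn dX expr1n.
  have : d ^+ 4 * z1 <= `|complex.Im (G alpha1)|.
    by rewrite leNgt; apply/negP => h; apply: nIm.
  move=> h; apply: le_trans (ler_wpM2l (ltW X'0) h).
  rewrite mulrA ler_peMl ?(ltW z10)// -dX4 mulrC ler_wpM2r//.
  by rewrite exprn_ge0// ltW.
- have := ler_wpM2l (mulr_ge0 (exprn_ge0 2 (ltW C0)) X's0) r1.
  by rewrite -/X' -/z1 in len1 *; lra.
- have := ler_wpM2l (mulr_ge0 (exprn_ge0 2 (ltW C0)) X's0) r2.
  by rewrite -/X' -/z1 in len2 *; lra.
Qed.

End Tame.
End Curves.

(** * Outer measure bounds on the line and subdivision of intervals *)

Section Coverings.
Context {R : realType}.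
Implicit Types (B : set (measurableTypeR R)) (a b c l s t alpha : R).

(** This bounds the outer measure of [B], so it applies to exceptional sets on curves whose
    measurability is left open. *)
Definition covered B c :=
  exists U : set (measurableTypeR R),
    [/\ measurable U, B `<=` U & (lebesgue_measure U <= c%:E)%E].

Lemma covered_sub B B' c c' : B `<=` B' -> c' <= c -> covered B' c' -> covered B c.
Proof.
move=> BB' cc' [U [mU BU Uc]]; exists U; split => //.
  exact: subset_trans BB' BU.
by apply: le_trans Uc _; rewrite lee_fin.
Qed.

Lemma covered0 c : 0 <= c -> covered set0 c.
Proof. by move=> c0; exists set0; split => //; rewrite measure0 lee_fin. Qed.

Lemma covered_itv a b : a <= b -> covered [set t | a <= t <= b] (b - a).
Proof.
move=> ab; exists `[a, b]%classic; split; first exact: measurable_itv.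
  by move=> t /=; rewrite in_itv.
rewrite lebesgue_measure_itv /= lte_fin; case: ifP => // _.
by rewrite lee_fin subr_ge0.
Qed.

Lemma coveredU B B' c c' : covered B c -> covered B' c' -> covered (B `|` B') (c + c').
Proof.
move=> [U [mU BU Uc]] [U' [mU' BU' Uc']]; exists (U `|` U'); split.
- exact: measurableU.
- exact: setUSS.
- by apply: le_trans (measureU2 _ mU mU') _; rewrite EFinD leeD.
Qed.

Lemma covered_finU N (F : nat -> set (measurableTypeR R)) c :
  (forall i, (i < N)%N -> covered (F i) c) ->
  covered [set t | exists2 i, (i < N)%N & F i t] (N%:R * c).
Proof.
elim: N => [|N IH] hF.
  rewrite mul0r; apply: (covered_sub _ (lexx _) (covered0 (lexx _))).
  by move=> t [].
have := coveredU (IH (fun i iN => hF i (ltnW iN))) (hF N (ltnSn N)).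
apply: covered_sub; last by rewrite -natr1 mulrDl mul1r.
move=> t [j]; rewrite ltnS leq_eqVlt => /orP[/eqP ->|jN Fj]; [by right|left].
by exists j.
Qed.

(** A set of diameter at most [c] lies within [c] of any of its points, so its [s]-neighbourhood
    lies in an interval of half-length [c + s]. *)
Lemma covered_nbhd B c s : 0 <= c -> 0 <= s ->
  (forall t t', B t -> B t' -> `|t' - t| <= c) ->
  covered [set t | exists2 t', B t' & `|t - t'| <= s] (2 * (c + s)).
Proof.
move=> c0 s0 hB; have [[t0 Bt0]|nB] := pselect (exists t, B t); last first.
  apply: (covered_sub (c' := 2 * (c + s)) _ (lexx _)); last first.
    by apply: covered0; rewrite mulr_ge0// addr_ge0.
  by move=> t [t' Bt']; exfalso; apply: nB; exists t'.
have := @covered_itv (t0 - (c + s)) (t0 + (c + s)).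
move/(_ ltac:(lra)); apply: covered_sub; last lra.
move=> t [t' Bt' tt'] /=; have := hB _ _ Bt0 Bt'.
move: tt'; rewrite !ler_norml => /andP[? ?] /andP[? ?]; apply/andP; split; lra.
Qed.

(** Gives the number of pieces into which an arc is cut. The factor [2] is the room left by the
    length conditions of [tame_image]. *)
Lemma nat_between c : 1 <= c -> exists2 N, (0 < N)%N & c <= N%:R <= 2 * c.
Proof.
move=> c1; exists (Num.truncn c).+1 => //.
have /andP[h1 h2] : (Num.truncn c)%:R <= c < (Num.truncn c).+1%:R.
  by apply: truncn_itv; lra.
by rewrite (ltW h2) /= -natr1; lra.
Qed.

Lemma subinterval_mem N alpha l t : 0 <= l -> (0 < N)%N -> alpha <= t <= alpha + l ->
  exists2 i, (i < N)%N & alpha + i%:R * (l / N%:R) <= t <= alpha + i%:R * (l / N%:R) + l / N%:R.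
Proof.
move=> l0 N0 /andP[h1 h2]; set s := l / N%:R.
have Ns : N%:R * s = l by rewrite /s mulrC divfK// pnatr_eq0 -lt0n.
have : alpha <= t <= alpha + N%:R * s by rewrite Ns h1 h2.
move: s {Ns} => s; elim: N N0 {h1 h2} => // N IH _ /andP[h1 h2].
have [tN|Nt] := leP t (alpha + N%:R * s).
  case: N IH h2 tN => [|N] IH h2 tN.
    by exists 0%N => //; rewrite mul0r addr0 h1 /=; move: h2; rewrite mul1r.
  have [//||j jN hj] := IH; first by rewrite h1.
  by exists j => //; exact: ltnW.
exists N => //; rewrite (ltW Nt) /=; move: h2; rewrite -natr1; lra.
Qed.

End Coverings.

(** * Measure of the failing times on a tame curve *)

Section Induction.
Context {R : realType}.
Local Arguments cmod : simpl never.
Variables (f f' : R[i] -> R[i]) (C X0 : R).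
Hypotheses (C200 : 200 <= C) (fexp : exp_like f f' C X0).
Implicit Types (z : R[i]) (s t X alpha l : R) (gamma zeta : R -> R[i]).

(** Only [n] steps are tested, so that bounds uniform in [n] can be proved by induction and passed
    to the limit. *)
Fixpoint good n z : Prop :=
  if n is k.+1 then
    expR (`|complex.Re z| / 2) <= `|complex.Re (f z)| /\ good k (f z)
  else True.

(** The arc is cut into [N] equal pieces. Those containing an exceptional time are discarded; on the
    others the image is tame at distance [X' = expR (X / 2)] and the induction hypothesis applies.
    As [X' >= 2 * X], the later losses use at most a quarter of the bound. *)
Lemma tame_covered n X alpha l gamma zeta :
  (forall Y, X <= Y -> large C X0 Y) -> tame C X alpha l gamma zeta ->
  covered [set t | alpha <= t <= alpha + l /\ ~ good n (gamma t)] (3 * C ^+ 3 / X ^+ 2 * l).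
Proof.
elim: n X alpha l gamma zeta => [|n IH] X alpha l gamma zeta hX T.
  have [_ X4 _] := hX X (lexx X).
  have l0 : 0 < l.
    have /(lt_le_trans ltr01) := tame_len_ge T.
    rewrite pmulr_lgt0 ?(tame_pos T)// pmulr_rgt0// mulr_gt0//; last lra.
    by rewrite mulr_gt0// exprn_gt0//; move: C200; lra.
  apply: (covered_sub (B' := set0) _ (lexx _)); first by move=> t [_ /(_ I)].
  apply: covered0; rewrite mulr_ge0 ?(ltW l0)// divr_ge0 ?sqr_ge0// mulr_ge0//.
  by rewrite exprn_ge0//; move: C200; lra.
have lX := hX X (lexx X).
have [_ X4 Xlarge] := lX.
have z0 := tame_pos T; set z := cmod (zeta alpha) in z0.
have X0' : 0 < X by lra.
have X1 : 1 <= X by lra.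
have C0 : 0 < C by move: C200; lra.
have C1 : 1 <= C by move: C200; lra.
have len := tame_len_ge T; rewrite -/z in len.
have l0 : 0 < l.
  have /(lt_le_trans ltr01) := len.
  by rewrite pmulr_lgt0// pmulr_rgt0// mulr_gt0// mulr_gt0// exprn_gt0.
have Ja : alpha <= alpha <= alpha + l by rewrite lexx lerDl ltW.
pose X' := expR (X / 2); have X'0 : 0 < X' by exact: expR_gt0.
rewrite -/X' in Xlarge.
pose F0 := cmod (f' (gamma alpha)).
pose L := cmod (f' (gamma alpha) * zeta alpha).
have LE : L = F0 * z by rewrite /L cmodM.
pose d := X^-1; have d0 : 0 < d by rewrite invr_gt0.
have dX : d * X = 1 by rewrite mulVf ?gt_eqF.
have C2 : 0 < C ^+ 2 by rewrite exprn_gt0.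
have XX4 : X <= X ^+ 4 by rewrite -{1}[X]expr1; exact: ler_weXn2l.
have C3 : 200 <= C ^+ 3.
  by apply: le_trans C200 _; rewrite -{1}[C]expr1; exact: ler_weXn2l.
have C28 : 8 <= C ^+ 2.
  apply: (@le_trans _ _ C); first by move: C200; lra.
  by rewrite -{1}[C]expr1; exact: ler_weXn2l.
have X'2 : 2 * X <= X'.
  apply: le_trans Xlarge; apply: ler_pM => //; [exact: ltW|lra].
have X'X : X <= X' by lra.
(* There will be at least [X ^+ 2] pieces, so discarding a piece costs at most [d ^+ 2 * l]. *)
have qX : X ^+ 2 <= 2 * C ^+ 2 * X' * l * L.
  have FX : X' * (C ^+ 2 * X ^+ 4) <= 2 * F0 := tame_deriv_large C200 fexp lX T Ja.
  rewrite LE -(@ler_pM2l _ (8 * X)) ?mulr_gt0//.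
  have F00 : 0 <= F0 := cmod_ge0 _.
  have h1 := ler_wpM2l (mulr_ge0 (ltW X'0) F00) len.
  have h2 := ler_wpM2l (ltW X'0) FX.
  have h3 : 8 * X ^+ 4 <= C ^+ 2 * X ^+ 4 by rewrite ler_wpM2r// exprn_ge0// ltW.
  have h4 : X ^+ 3 <= X ^+ 4 by exact: ler_weXn2l.
  have h5 : C ^+ 2 * X ^+ 4 <= X' * X' * (C ^+ 2 * X ^+ 4).
    rewrite ler_peMl ?mulr_ge0 ?exprn_ge0 ?(ltW C0) ?(ltW X0')//.
    by rewrite -[1]mulr1; apply: ler_pM => //; lra.
  have -> : 8 * X * X ^+ 2 = 8 * X ^+ 3 by ring.
  lra.
have q1 : 1 <= 2 * C ^+ 2 * X' * l * L.
  by apply: le_trans qX; rewrite exprn_ege1.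
(* With [q = 2 * C ^+ 2 * X' * l * L], the bounds [q <= N <= 2 * q] are exactly the two length
   conditions of [tame_image]. *)
have [N N0 /andP[qN Nq]] := nat_between q1.
have NR : 0 < N%:R :> R by rewrite ltr0n.
pose s := l / N%:R; have s0 : 0 < s by rewrite divr_gt0.
have Ns : N%:R * s = l by rewrite /s mulrC divfK// gt_eqF.
have d2X2 : d ^+ 2 * X ^+ 2 = 1 by rewrite -exprMn dX expr1n.
have sd : s <= d ^+ 2 * l.
  have h := ler_wpM2r (ltW s0) (le_trans qX qN); rewrite Ns in h.
  by have := ler_wpM2l (sqr_ge0 d) h; rewrite mulrA d2X2 mul1r.
pose D := 7 * d ^+ 3 / z.
have D0 : 0 <= D by rewrite mulr_ge0 ?invr_ge0 ?(ltW z0)// mulr_ge0// exprn_ge0// ltW.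
(* The lower length bound of [tame] gives [1 / z <= 8 * C ^+ 2 * X * l], which turns [d ^+ 3 / z]
   into a multiple of [d ^+ 2 * l]. *)
have DE : D <= 56 * (C ^+ 2 * (d ^+ 2 * l)).
  rewrite /D ler_pdivrMr//.
  have := ler_wpM2l (exprn_ge0 3 (ltW d0)) len.
  have -> : d ^+ 3 * (8 * C ^+ 2 * X * l * z) = 8 * C ^+ 2 * d ^+ 2 * l * z * (d * X) by ring.
  rewrite dX; lra.
pose B1 : set (measurableTypeR R) := [set t | exc_Re f X alpha l gamma t].
pose B2 : set (measurableTypeR R) := [set t | exc_Im f' X alpha l gamma zeta t].
have V1 : covered [set t | exists2 t', B1 t' & `|t - t'| <= s] (2 * (D + s)).
  by apply: covered_nbhd => //; [exact: ltW|move=> t t'; exact: (exc_Re_sep C200 fexp lX T)].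
have V2 : covered [set t | exists2 t', B2 t' & `|t - t'| <= s] (2 * (D + s)).
  by apply: covered_nbhd => //; [exact: ltW|move=> t t'; exact: (exc_Im_sep C200 fexp lX T)].
pose a i := alpha + i%:R * s.
(* The later failures on the [i]-th piece; freedom from exceptional times is built in, so [F i] is
   empty for a discarded piece. *)
pose F i : set (measurableTypeR R) := [set t | [/\ a i <= t <= a i + s,
  ~ good n (f (gamma t)) & forall t', a i <= t' <= a i + s -> ~ B1 t' /\ ~ B2 t']].
have cF i : (i < N)%N -> covered (F i) (3 * C ^+ 3 / X' ^+ 2 * s).
  move=> iN; have ai : alpha <= a i by rewrite /a lerDl mulr_ge0// ltW.
  have ais : a i + s <= alpha + l.
    have : i.+1%:R * s <= N%:R * s by rewrite ler_wpM2r ?(ltW s0)// ler_nat.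
    by rewrite Ns -natr1 /a; lra.
  have [[t ht]|nt] := pselect (exists t, F i t); last first.
    apply: (covered_sub (B' := set0) _ (lexx _)); first by move=> t Ft; apply: nt; exists t.
    by apply: covered0; rewrite mulr_ge0 ?(ltW s0)// divr_ge0 ?sqr_ge0// mulr_ge0// exprn_ge0// ltW.
  have [_ _ nexc] := ht.
  have T' : tame C X' (a i) s (f \o gamma) (fun t => f' (gamma t) * zeta t).
    apply: (tame_image C200 fexp lX T (ltW s0) ai ais).
    - by move=> t' /nexc[].
    - by have [|_] := nexc (a i); rewrite ?lexx ?lerDl ?ltW.
    - rewrite -/X' -/L -(ler_pM2l NR) mulr1; apply: le_trans qN.
      by rewrite -Ns le_eqVlt; apply/orP; left; apply/eqP; ring.
    - rewrite -/X' -/L -(ler_pM2l NR) mulr1; apply: le_trans Nq _.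
      by rewrite -Ns le_eqVlt; apply/orP; left; apply/eqP; ring.
  have hX' Y : X' <= Y -> large C X0 Y by move=> h; apply: hX; exact: le_trans h.
  have := IH _ _ _ _ _ hX' T'; apply: covered_sub => // t' [h1 h2 _]; split => //.
have := coveredU (coveredU V1 V2) (covered_finU cF).
apply: covered_sub.
  move=> t [tJ ngood].
  have [i iN hi] := subinterval_mem (ltW l0) N0 tJ; rewrite -/s -/(a i) in hi.
  have close t' : a i <= t' <= a i + s -> `|t - t'| <= s.
    move: hi; rewrite ler_norml; clear => /andP[? ?] /andP[? ?].
    by apply/andP; split; lra.
  have [[t' [h B1t']]|n1] := pselect (exists t', a i <= t' <= a i + s /\ B1 t').
    by left; left; exists t' => //; exact: close.
  have [[t' [h B2t']]|n2] := pselect (exists t', a i <= t' <= a i + s /\ B2 t').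
    by left; right; exists t' => //; exact: close.
  right; exists i => //; split => //.
    move=> gn; apply: ngood; split => //; apply: (not_exc_Re_good C200 fexp lX T tJ).
    by move=> ht; apply: n1; exists t.
  by move=> t' ht'; split => h; [apply: n1|apply: n2]; exists t'.
have -> : N%:R * (3 * C ^+ 3 / X' ^+ 2 * s) = 3 * C ^+ 3 / X' ^+ 2 * l by rewrite -Ns; ring.
have dE : 3 * C ^+ 3 / X ^+ 2 * l = 3 * (C ^+ 3 * (d ^+ 2 * l)) by rewrite exprVn; ring.
have d'E : 3 * C ^+ 3 / X' ^+ 2 * l = 3 * (C ^+ 3 * (X'^-1 ^+ 2 * l)) by rewrite exprVn; ring.
have X'd : 2 * X'^-1 <= d.
  by rewrite -(ler_pM2l X0') [X * d]mulrC dX mulrA ler_pdivrMr// mul1r mulrC.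
have X'd2 : 4 * X'^-1 ^+ 2 <= d ^+ 2.
  have -> : 4 * X'^-1 ^+ 2 = (2 * X'^-1) ^+ 2 by ring.
  by rewrite ler_sqr ?nnegrE ?(ltW d0)// mulr_ge0// invr_ge0 ltW.
have C3l : 0 <= C ^+ 3 * l by rewrite mulr_ge0 ?exprn_ge0 ?(ltW C0) ?(ltW l0).
have h1 := ler_wpM2l C3l X'd2.
have d2l : 0 <= d ^+ 2 * l by rewrite mulr_ge0 ?sqr_ge0 ?(ltW l0).
have C2d := mulr_ge0 (ltW C2) d2l.
have h2 : 200 * (C ^+ 2 * (d ^+ 2 * l)) <= C ^+ 3 * (d ^+ 2 * l).
  by rewrite [C ^+ 3]exprS -[leRHS]mulrA ler_wpM2r.
have h3 : d ^+ 2 * l <= C ^+ 2 * (d ^+ 2 * l) by rewrite ler_peMl//; lra.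
(* In units of [C ^+ 3 * (d ^+ 2 * l)], the discarded pieces cost at most [4 * 57 / C <= 1.14] and
   the later steps [3 / 4], together less than [3]. *)
rewrite dE d'E; lra.
Qed.

End Induction.

(** * Vertical segments as initial curves *)

Section VerticalLines.
Context {R : realType}.
Local Arguments cmod : simpl never.
Variables (f f' : R[i] -> R[i]) (C X0 : R).
Hypotheses (C200 : 200 <= C) (fexp : exp_like f f' C X0).

(** A vertical line has constant velocity ['i], so its error terms vanish, and pieces of length
    between [1 / (2 * C ^+ 2 * X)] and [1 / (C ^+ 2 * X)] are tame. *)
Lemma vertical_covered n (x a L : R) : 1 <= L ->
  (forall Y, `|x| <= Y -> large C X0 Y) ->
  covered [set y | a <= y <= a + L /\ ~ good f n (x +i* y)]
    (3 * C ^+ 3 / `|x| ^+ 2 * L).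
Proof.
move=> L1 hx; set X := `|x|; have [_ X4 _] := hx X (lexx _).
have C0 : 0 < C by move: C200; lra.
have C2 : 1 <= C ^+ 2 by rewrite exprn_ege1//; move: C200; lra.
have Xp : 0 < X by lra.
have q1 : 1 <= C ^+ 2 * X * L.
  by rewrite -[1]mulr1 ler_pM// -[1]mulr1 ler_pM//; lra.
have [N N0 /andP[qN Nq]] := nat_between q1.
have NR : 0 < N%:R :> R by rewrite ltr0n.
pose s := L / N%:R; have s0 : 0 < s by rewrite divr_gt0//; lra.
have Ns : N%:R * s = L by rewrite /s mulrC divfK// gt_eqF.
have ci : cmod ('i : R[i]) = 1 by rewrite /cmod/= expr0n expr1n add0r sqrtr1.
pose b i := a + i%:R * s.
have T i : tame C X (b i) s (fun y => x +i* y) (fun=> 'i).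
  split.
  - by rewrite ci.
  - by move=> t _ /=.
  - move=> t t' _ _; have -> : (x +i* t') - (x +i* t) - 'i * (t' - t)%:C = 0.
      by apply/eqP; rewrite eq_complex /=; apply/andP; split; apply/eqP; ring.
    by rewrite cmod0 mulr_ge0 ?sqr_ge0// divr_ge0 ?sqr_ge0// mulr_ge0// ltW.
  - move=> t t' _ _; rewrite subrr cmod0 mulr_ge0// divr_ge0 ?sqr_ge0// mulr_ge0// ltW//.
  - by rewrite ci /= normr1 mulr1; lra.
  - rewrite ci mulr1 -(ler_pM2l NR) mulr1; apply: le_trans qN.
    by rewrite -Ns le_eqVlt; apply/orP; left; apply/eqP; ring.
  - rewrite ci mulr1 -(ler_pM2l NR) mulr1; apply: le_trans Nq _.
    have -> : N%:R * (8 * C ^+ 2 * X * s) = 8 * (C ^+ 2 * X * L) by rewrite -Ns; ring.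
    by rewrite ler_wpM2r//; lra.
have := covered_finU (fun i (_ : (i < N)%N) => tame_covered C200 fexp n hx (T i)).
apply: covered_sub; last by rewrite mulrCA Ns.
move=> y [yL ngood].
have [i iN hi] := subinterval_mem (le_trans ler01 L1) N0 yL.
by exists i.
Qed.

End VerticalLines.

(** * From good orbits to the fast escaping set *)

Section Escape.
Context {R : realType}.
Local Arguments cmod : simpl never.
Implicit Types (C X Y : R) (z : R[i]).

(** [expR (Y / 2)] is the fifth power of [expR (Y / 10) >= Y / 10], one degree more than [Y ^+ 4];
    the threshold [10 ^+ 5 * C ^+ 3] takes care of the constants. *)
Lemma large_eventually C (X0 : R) : 200 <= C ->
  exists2 X1, 8 <= X1 & forall Y, X1 <= Y -> large C X0 Y.
Proof.
move=> C200; have C3 : 0 <= C ^+ 3 by rewrite exprn_ge0//; lra.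
exists (Num.max 8 (Num.max X0 (10 ^+ 5 * C ^+ 3))); first by rewrite le_max lexx.
move=> Y; rewrite !ge_max => /and3P[Y8 YX0 YC]; split => //; first lra.
have -> : Y / 2 = 5%:R * (Y / 10) by lra.
rewrite expRM_natl.
have h1 : (Y / 10) ^+ 5 <= expR (Y / 10) ^+ 5.
  apply: lerXn2r; rewrite ?nnegrE ?expR_ge0//; first lra.
  by have := expR_ge1Dx (Y / 10); lra.
apply: le_trans h1; rewrite expr_div_n ler_pdivlMr ?exprn_gt0//.
rewrite [Y ^+ 5]exprS mulrAC ler_wpM2r ?exprn_ge0//; first lra.
by rewrite mulrC.
Qed.

Variable f : R[i] -> R[i].

Lemma good_le i j z : (i <= j)%N -> good f j z -> good f i z.
Proof.
elim: j i z => [|j IH] [|i] z //= ij [h1 h2]; split => //; exact: IH.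
Qed.

(** For [y >= 8] one has [expR (y / 2) >= (1 + y / 4) ^+ 2 >= y + 1]. Linear growth suffices to
    reach any prescribed distance from the axis. *)
Lemma good_growth z : 8 <= `|complex.Re z| -> (forall n, good f n z) ->
  forall l, `|complex.Re z| + l%:R <= `|complex.Re (iter l f z)| /\
    forall n, good f n (iter l f z).
Proof.
move=> z8 gz; elim => [|l [IH1 IH2]]; first by rewrite addr0.
split; last by move=> n; have [_] := IH2 n.+1.
have [h _] := IH2 1%N; rewrite /= in h *.
apply: le_trans h; rewrite -natr1 addrA.
move: IH1; set y := `|complex.Re (iter l f z)| => IH1.
have y8 : 8 <= y by have := ler0n R l; lra.
have -> : y / 2 = y / 4 + y / 4 by lra.
rewrite expRD; have h1 := expR_ge1Dx (y / 4).
have h2 : (1 + y / 4) * (1 + y / 4) <= expR (y / 4) * expR (y / 4).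
  by apply: ler_pM => //; lra.
by have := ler_wpM2r (ltW (lt_le_trans (ltr0Sn R 7) y8)) y8; lra.
Qed.

Variables (A q : R).
Hypotheses (A0 : 0 <= A) (q1 : 1 <= q).
Hypothesis growth : forall z, cmod (f z) <= A * expR (q * cmod z).

Lemma max_modulus_le r : max_modulus f r <= A * expR (q * r).
Proof.
(* For negative [r] the circle is empty and [sup] takes its default value [0]. *)
have [r0|r0] := lerP 0 r; last first.
  rewrite /max_modulus; have -> : [set cmod (f z) | z in [set z | cmod z = r]] = set0.
    rewrite -subset0 => y [z /= zr _]; have := cmod_ge0 z; rewrite zr; lra.
  by rewrite sup0 mulr_ge0// expR_ge0.
apply: ge_sup.
  by exists (cmod (f r%:C)); exists r%:C => //=; rewrite cmod_real ger0_norm.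
by move=> y [z /= zr <-]; rewrite -zr.
Qed.

(* The factor 4 beats the loss of a factor 2 in the exponent in [good]. *)
Lemma good_ge_iter_max_modulus k (w : R[i]) u v : (forall n, good f n w) ->
  u <= v -> 4 * (A + 1) <= v -> 4 * (q * v) <= `|complex.Re w| ->
  iter k (max_modulus f) u <= cmod (iter k f w).
Proof.
have bA := A0; have bq := q1.
elim: k w u v => [|k IH] w u v gw uv vA qv.
  have v0 : 0 <= v by lra.
  apply: le_trans uv _; apply: le_trans (Re_le_cmod w); apply: le_trans qv.
  have : v <= q * v by rewrite ler_peMl.
  lra.
have v0 : 0 <= v by lra.
have vq : v <= q * v by rewrite ler_peMl.
(* [v'] bounds [max_modulus f u] and takes the place of [v] at the next step. *)
pose v' := (A + 1) * expR (q * v).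
have e1 : v <= expR (q * v) by have := expR_ge1Dx (q * v); lra.
have e2 : expR (q * v) <= v' by rewrite ler_peMl ?expR_ge0//; lra.
rewrite !iterSr; apply: (IH _ _ v').
- by move=> n; have [_] := gw n.+1.
- apply: le_trans (max_modulus_le u) _; apply: ler_pM => //; rewrite ?expR_ge0//; first lra.
  by rewrite ler_expR ler_wpM2l//; lra.
- lra.
(* Half of [4 * (q * v)] is [q * v + q * v]: one factor [expR (q * v)] is at least
   [4 * (q * (A + 1))], the other is the one in [v']. *)
- have [h _] := gw 1%N; apply: le_trans h.
  apply: (@le_trans _ _ (expR (q * v + q * v))); last by rewrite ler_expR; lra.
  rewrite expRD /v' mulrA mulrA ler_wpM2r ?expR_ge0//.
  have := expR_ge1Dx (q * v); have := ler_wpM2l (le_trans ler01 bq) vA; lra.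
Qed.

(** After a delay [l] the orbit is at distance at least [4 * (q * v)] from the axis; from then on it
    keeps ahead of the iterated maximal modulus started at [r0]. *)
Lemma good_fast_escaping r0 z : 8 <= `|complex.Re z| -> (forall n, good f n z) ->
  fast_escaping f r0 z.
Proof.
move=> z8 gz; pose v := Num.max r0 (4 * (A + 1)).
have [l hl] : exists l : nat, 4 * (q * v) <= l%:R.
  exists (Num.truncn `|4 * (q * v)|).+1.
  have /andP[_ h] := truncn_itv (normr_ge0 (4 * (q * v))).
  by apply: le_trans (ler_norm _) (ltW h).
exists l => n; rewrite iterD.
have [h1 h2] := good_growth z8 gz l.
apply: (good_ge_iter_max_modulus n h2 (v := v)).
- by rewrite le_max lexx.
- by rewrite le_max lexx orbT.
- by move: h1; have := normr_ge0 (complex.Re z); lra.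
Qed.

End Escape.

(** * Measurability of the sets defined by iteration *)

Section Measurability.
Context {d : measure_display} {T : measurableType d} {R : realType}.
Local Arguments cmod : simpl never.
Implicit Types (g h : T -> R[i]).

Definition cmeasurable g :=
  measurable_fun setT (fun p => complex.Re (g p) : R) /\
  measurable_fun setT (fun p => complex.Im (g p) : R).

Lemma cmeasurable_cst (c : R[i]) : cmeasurable (fun=> c).
Proof. by split; exact: measurable_cst. Qed.

Lemma cmeasurableD g h : cmeasurable g -> cmeasurable h ->
  cmeasurable (fun p => g p + h p).
Proof.
move=> [g1 g2] [h1 h2]; split.
  by under eq_fun do rewrite ReD; exact: measurable_funD.
by under eq_fun do rewrite ImD; exact: measurable_funD.
Qed.

Lemma cmeasurableM g h : cmeasurable g -> cmeasurable h ->
  cmeasurable (fun p => g p * h p).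
Proof.
move=> [g1 g2] [h1 h2]; split.
  under eq_fun do rewrite ReM.
  by apply: measurable_funB; exact: measurable_funM.
under eq_fun do rewrite ImM.
by apply: measurable_funD; exact: measurable_funM.
Qed.

Lemma cmeasurable_cexp g : cmeasurable g -> cmeasurable (fun p => cexp (g p)).
Proof.
move=> [g1 g2].
have mexp := measurableT_comp (@measurable_expR R) g1.
have mcos := measurableT_comp (continuous_measurable_fun (@continuous_cos R)) g2.
have msin := measurableT_comp (continuous_measurable_fun (@continuous_sin R)) g2.
by split; exact: measurable_funM.
Qed.

Lemma cmeasurable_exp_poly a n g : cmeasurable g ->
  cmeasurable (fun p => exp_poly a n (g p)).
Proof.
move=> mg; rewrite /exp_poly.
elim: (index_enum _) => [|k s IH].
  by under eq_fun do rewrite big_nil; exact: cmeasurable_cst.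
under eq_fun do rewrite big_cons; apply: cmeasurableD => //.
apply: cmeasurableM; first exact: cmeasurable_cst.
by apply/cmeasurable_cexp/cmeasurableM => //; exact: cmeasurable_cst.
Qed.

Lemma cmeasurable_cmod g : cmeasurable g -> measurable_fun setT (fun p => cmod (g p)).
Proof.
move=> [g1 g2].
have -> : (fun p => cmod (g p)) = Num.sqrt \o
    (fun p => complex.Re (g p) ^+ 2 + complex.Im (g p) ^+ 2).
  by apply/funext => p /=; rewrite -cmod_sqr sqrtr_sqr ger0_norm// cmod_ge0.
apply: measurableT_comp; first exact: continuous_measurable_fun (@sqrt_continuous R).
by apply: measurable_funD; exact: measurable_funX.
Qed.

Lemma measurable_le (g h : T -> R) : measurable_fun setT g -> measurable_fun setT h ->
  measurable [set p | g p <= h p].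
Proof. by move=> mg mh; rewrite -[X in measurable X]setTI; exact: measurable_fun_le. Qed.

Lemma measurable_good a n k g : cmeasurable g ->
  measurable [set p | good (exp_poly a n) k (g p)].
Proof.
elim: k g => [|k IH] g mg /=; first by rewrite -[X in measurable X]/setT; exact: measurableT.
have mfg := cmeasurable_exp_poly a n mg.
apply: measurableI; last exact: (IH _ mfg).
apply: measurable_le; last by apply: measurableT_comp => //; case: mfg.
apply: measurableT_comp; first exact: measurable_expR.
apply: measurable_funM; last exact: measurable_cst.
by apply: measurableT_comp => //; case: mg.
Qed.

(** Countably many conditions, each comparing the modulus of an iterate with a number that does not
    depend on the point. *)
Lemma measurable_fast_escaping a n r0 g : cmeasurable g ->
  measurable [set p | fast_escaping (exp_poly a n) r0 (g p)].
Proof.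
move=> mg; set f := exp_poly a n.
have -> : [set p | fast_escaping f r0 (g p)] =
  \bigcup_l \bigcap_k [set p | iter k (max_modulus f) r0 <= cmod (iter (k + l) f (g p))].
  apply/seteqP; split => p /=.
    by move=> [l hl]; exists l => // k _; exact: hl.
  by move=> [l _ hl]; exists l => k; exact: hl.
apply: bigcup_measurable => l _; apply: bigcap_measurable => // k _.
apply: measurable_le; first exact: measurable_cst.
apply: cmeasurable_cmod; elim: (k + l)%N => [//|j IH] /=.
exact: cmeasurable_exp_poly.
Qed.

End Measurability.

(** * Area by integration over vertical sections *)

Section Area.
Context {R : realType}.
Local Notation mR := (measurableTypeR R).
Local Notation mu := (@lebesgue_measure R).
Local Open Scope ereal_scope.

Lemma integral_oneDsqrV : \int[mu]_x ((oneDsqr x)^-1)%:E = (pi : R)%:E.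
Proof.
rewrite ge0_symfun_integralT/=; last 3 first.
- by move=> x; rewrite invr_ge0 (le_trans ler01)// oneDsqr_ge1.
- exact: continuous_oneDsqrV.
- by move=> x /=; rewrite /oneDsqr sqrrN.
rewrite -set_itvcy integral0y_oneDsqr -EFinM; congr EFin.
by rewrite mulrC divfK.
Qed.

(** Fubini with the integrable majorant [c / (1 + x^2)], whose integral is [c * pi]. *)
Lemma area_le_sections (B : set (mR * mR)) (c : R) : (0 <= c)%R -> measurable B ->
  (forall x, mu (xsection B x) <= (c / oneDsqr x)%:E) ->
  (mu \x mu) B <= (c * pi)%:E.
Proof.
move=> c0 mB hB; rewrite /product_measure1/=.
have -> : (c * pi)%:E = \int[mu]_x (c%:E * ((oneDsqr x)^-1)%:E).
  rewrite ge0_integralZl//.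
  - by rewrite integral_oneDsqrV.
  - apply/measurable_EFinP; exact: continuous_measurable_fun (@continuous_oneDsqrV R).
apply: ge0_le_integral => //.
- exact: measurable_fun_xsection.
- apply: measurable_funeM; apply/measurable_EFinP.
  exact: continuous_measurable_fun (@continuous_oneDsqrV R).
Qed.

End Area.

(** * Finite area of the complement of the fast escaping set in a strip *)

Unset Implicit Arguments.
Set Strict Implicit.
Set Printing Implicit Defensive.

Theorem theorem1p1 (R : realType) (P : {poly R[i]})
    (degP : (2 <= (size P).-1)%N) (P0 : P.[0] != 0)
    (f : R[i] -> R[i]) (fE : forall z, f z = P.[cexp z] / cexp z)
    (r0 : R) (hr0 : admissible_radius f r0) (a : R) :
  finite_area (horizontal_strip a `&` ~` fast_escaping f r0).
Proof.
have n3 : (3 <= size P)%N by case: (size P) degP.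
have {fE hr0} -> : f = exp_poly (fun k => P`_k) (size P).
  by apply/funext => z; rewrite fE poly_cexp_div.
set g := exp_poly _ _; set n := size P in n3 g *; pose b := fun k : nat => P`_k.
(* [P(0)] and the leading coefficient belong to the terms that dominate to the left and to the right
   of the axis. *)
have b0 : b 0%N != 0 by rewrite /b -horner_coef0.
have bn : b n.-1 != 0.
  by rewrite /b -/(lead_coef P) lead_coef_eq0 -size_poly_gt0 -/n; case: (n) n3.
have [C [X0 [C200 gexp]]] := exp_poly_exp_like n3 b0 bn.
rewrite -/g in gexp.
have [X1 X18 hX1] := large_eventually X0 C200.
have C0 : 0 < C by lra.
have growth z : cmod (g z) <= coef_norm b n * expR (n%:R * cmod z) := exp_poly_growth b n z.
have n1 : 1 <= n%:R :> R by rewrite ler1n; case: (n) n3.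
have escape z : X1 <= `|complex.Re z| -> (forall k, good g k z) -> fast_escaping g r0 z.
  move=> hz; apply: (good_fast_escaping (coef_norm_ge0 b n) n1 growth).
  exact: le_trans hz.
pose mR := measurableTypeR R.
pose pt (p : mR * mR) : R[i] := p.1 +i* p.2.
have mpt : cmeasurable pt by split; [exact: measurable_fst|exact: measurable_snd].
have pi3 : 1 <= 2 * pi :> R by have := @pi_ge2 R; lra.
pose S : set (mR * mR) := [set p | a <= p.2 <= a + 2 * pi].
have mS : measurable S.
  rewrite (_ : S = [set p | a <= p.2] `&` [set p | p.2 <= a + 2 * pi]).
    by apply: measurableI; apply: measurable_le => //; exact: measurable_cst.
  by apply/seteqP; split => p /=; [move=> /andP[]|move=> [? ?]; apply/andP].
pose A := plane_set (horizontal_strip a `&` ~` fast_escaping g r0).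
have mA : measurable A.
  rewrite (_ : A = S `&` ~` [set p | fast_escaping g r0 (pt p)])//.
  by apply: measurableI => //; apply: measurableC; exact: measurable_fast_escaping.
(* The points of the strip away from the axis that fail within [k] steps; these sets increase with
   [k]. *)
pose B k : set (mR * mR) := [set p | X1 <= `|p.1|] `&` (S `&` ~` [set p | good g k (pt p)]).
have mB k : measurable (B k).
  apply: measurableI; last first.
    by apply: measurableI => //; apply: measurableC; exact: measurable_good.
  apply: measurable_le; first exact: measurable_cst.
  by apply: measurableT_comp => //; exact: measurable_fst.
(* The part of the strip near the axis lies in this bounded rectangle. *)
pose Q : set (mR * mR) := `[- X1, X1]%classic `*` `[a, a + 2 * pi]%classic.
have mQ : measurable Q by apply: measurableX; exact: measurable_itv.
have muQ : ((@lebesgue_measure R \x @lebesgue_measure R) Q < +oo)%E.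
  rewrite product_measure1E; [|exact: measurable_itv..].
  rewrite /= !lebesgue_measure_itv/=.
  by do 2! case: ifP => _; rewrite ?mule0 ?mul0e// -?EFinN -?EFinD -?EFinM ltry.
(* Twice the constant for a segment of length [2 * pi], because [1 + x^2 <= 2 * x^2] for
   [|x| >= 1]. *)
pose c : R := 2 * (3 * C ^+ 3 * (2 * pi)).
have c0 : 0 <= c by rewrite /c !mulr_ge0 ?pi_ge0 ?exprn_ge0 ?(ltW C0)//.
have muB k : ((@lebesgue_measure R \x @lebesgue_measure R) (B k) <= (c * pi)%:E)%E.
  apply: area_le_sections => // x.
  have [xX1|xX1] := ltP `|x| X1.
    rewrite (_ : xsection (B k) x = set0).
      by rewrite measure0 lee_fin divr_ge0// (le_trans ler01)// oneDsqr_ge1.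
    rewrite -subset0 => y; rewrite /xsection/= inE => -[/= h _].
    by move: xX1; rewrite ltNge h.
  have [U [mU BU Uc]] := @vertical_covered R g _ C X0 C200 gexp k x a (2 * pi) pi3
    (fun Y xY => hX1 Y (le_trans xX1 xY)).
  apply: (@le_trans _ _ (lebesgue_measure U)).
    apply: le_measure; rewrite ?inE//; first exact: measurable_xsection.
    by apply: subset_trans BU => y; rewrite /xsection/= inE => -[/= _ [? ?]].
  apply: le_trans Uc _; rewrite lee_fin /c.
  set k3 := 3 * C ^+ 3; have k30 : 0 <= k3 by rewrite mulr_ge0// exprn_ge0// ltW.
  rewrite mulrAC ler_pdivrMr; last by rewrite exprn_gt0//; lra.
  have o0 : 0 < oneDsqr x by rewrite (lt_le_trans ltr01)// oneDsqr_ge1.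
  rewrite [leRHS]mulrAC ler_pdivlMr//.
  have kp0 : 0 <= k3 * (2 * pi) by rewrite mulr_ge0//; lra.
  have x1 : 1 <= `|x| ^+ 2 by rewrite exprn_ege1//; lra.
  have -> : 2 * (k3 * (2 * pi)) * `|x| ^+ 2 = k3 * (2 * pi) * (2 * `|x| ^+ 2) by ring.
  rewrite ler_wpM2l// /oneDsqr -[x ^+ 2]real_normK ?num_real//; lra.
have mUB : measurable (\bigcup_k B k) by exact: bigcup_measurable.
have muUB : ((@lebesgue_measure R \x @lebesgue_measure R) (\bigcup_k B k) <= (c * pi)%:E)%E.
  have homB : {homo B : i j / (i <= j)%N >-> (i <= j)%O}.
    move=> i j ij; apply/subsetPset => p [h1 [h2 h3]]; split => //; split => // h4.
    by apply: h3; exact: good_le h4.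
  (* Continuity of the measure from below carries the bound, uniform in [k], over to the union. *)
  have cvB := @nondecreasing_cvg_mu _ _ R (@lebesgue_measure R \x @lebesgue_measure R)%E
    B mB mUB homB.
  rewrite -(cvg_lim _ cvB)//; apply: lime_le; first by apply/cvg_ex; eexists; exact: cvB.
  by apply: nearW => k; exact: muB.
(* Outside the rectangle, a point all of whose steps are good escapes fast, so any other point fails
   at some finite [k]. *)
have AQB : A `<=` Q `|` \bigcup_k B k.
  move=> p [Sp nesc]; have [pX1|pX1] := ltP `|p.1| X1.
    left; split; rewrite /= in_itv//=.
    by rewrite -ler_norml ltW.
  right; have [k nk] : exists k, ~ good g k (pt p).
    apply: contrapT => h; apply: nesc; apply: escape => // k.
    by apply: contrapT => h'; apply: h; exists k.
  by exists k.
split => //; apply: (@le_lt_trans _ _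
  ((@lebesgue_measure R \x @lebesgue_measure R) (Q `|` \bigcup_k B k))%E).
  by apply: le_measure; rewrite ?inE//; exact: measurableU.
apply: le_lt_trans (measureU2 _ mQ mUB) _.
rewrite lte_add_pinfty//; last exact: le_lt_trans muUB (ltry _).
Qed.
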